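(* There exist a computable probability measure $P$ on $2^{\mathbb N}\times 2^{\mathbb N}$ and a pair of sequences $(\alpha,\beta)\in 2^{\mathbb N}\times 2^{\mathbb N}$ such that $(\alpha,\beta)$ is $P$-random and $\alpha$ is not $P_C(\cdot\mid\beta)$-random (in particular, not even without an oracle for $\beta$).
   Context: $2^{\mathbb N}$ denotes Cantor space; for a finite binary string $x$, $[x]$ is the set of infinite sequences extending $x$. A measure $P$ on $2^{\mathbb N}\times 2^{\mathbb N}$ is computable if the map $(x,y)\mapsto P([x]\times[y])$ on pairs of strings is computable as a real-valued function (similarly for measures on $2^{\mathbb N}$). The marginal measure is $P_M(S)=P(2^{\mathbb N}\times S)$. For $\beta\in 2^{\mathbb N}$ and measurable $S\subseteq 2^{\mathbb N}$, the conditional measure is $P_C(S\mid\beta)=\lim_{n\to\infty}\frac{P(S\times[\beta_1\dots\beta_n])}{P(2^{\mathbb N}\times[\beta_1\dots\beta_n])}$ (when the limit exists). For a measure $Q$ on $2^{\mathbb N}$ (possibly non-computable), a $Q$-Martin-Löf test is a sequence $(V_n)_{n\in\mathbb N}$ of subsets of $2^{\mathbb N}$ that are uniformly effectively open (without any oracle) with $Q(V_n)\le 2^{-n}$ for all $n$; a sequence is $Q$-random if it does not belong to $\bigcap_n V_n$ for any $Q$-Martin-Löf test (this is ''blind'' or ''Hippocratic'' randomness). $P$-randomness of a pair for a measure $P$ on $2^{\mathbb N}\times 2^{\mathbb N}$ is defined in the same way using uniformly effectively open subsets $V_n\subseteq 2^{\mathbb N}\times 2^{\mathbb N}$ with $P(V_n)\le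 2^{-n}$. It is known that if $(\alpha,\beta)$ is $P$-random for computable $P$, then $\beta$ is $P_M$-random and $P_C(\cdot\mid\beta)$ is defined and is a measure. *)

(* Defs.v *)
From HB Require Import structures.
From mathcomp Require Import all_boot all_order all_algebra.
From mathcomp Require Import all_classical all_reals all_analysis.

Set Implicit Arguments.
Unset Strict Implicit.
Unset Printing Implicit Defensive.

Import Order.TTheory GRing.Theory Num.Theory.
Import numFieldNormedType.Exports.

Local Open Scope classical_set_scope.
Local Open Scope ring_scope.

(* Kleene's mu-recursive functions.  Codes are not indexed by their arity:
   arguments are lists, and a missing argument reads as 0. *)
Inductive mu_code : Type :=
| MZero
| MSucc
| MProj of nat
| MComp of mu_code & seq mu_code
| MPrec of mu_code & mu_code
| MMin of mu_code.

(* [mu_eval c xs y]: the partial function computed by [c] is defined on [xs],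
   with value [y]. *)
Fixpoint mu_eval (c : mu_code) (xs : seq nat) (y : nat) {struct c} : Prop :=
  match c with
  | MZero => y = 0%N
  | MSucc => y = (head 0 xs).+1%N
  | MProj i => y = nth 0%N xs i
  | MComp f gs =>
      exists2 ys : seq nat,
        (fix values (gs : seq mu_code) (ys : seq nat) {struct gs} : Prop :=
           match gs, ys with
           | [::], [::] => True
           | g :: gs', z :: ys' => mu_eval g xs z /\ values gs' ys'
           | _, _ => False
           end) gs ys
        & mu_eval f ys y
  | MPrec f g =>
      (fix prec (n z : nat) {struct n} : Prop :=
         match n with
         | 0%N => mu_eval f (behead xs) z
         | m.+1%N =>
             exists2 w : nat, prec m w & mu_eval g [:: m, w & behead xs] z
         end) (head 0%N xs) y
  | MMin f =>
      mu_eval f (y :: xs) 0%N /\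
      forall m : nat, (m < y)%N -> exists z : nat, mu_eval f (m :: xs) z.+1
  end.

Definition mu_halts (c : mu_code) (xs : seq nat) : Prop :=
  exists y : nat, mu_eval c xs y.

(* Bijective base-2 numeration: a bijection between binary strings and nat. *)
Definition string_code (x : seq bool) : nat :=
  foldr (fun (b : bool) (m : nat) => (m.*2 + b).+1)%N 0%N x.

(* Approximation by rationals (a - b) / (d + 1) up to an arbitrary 2^-k, with
   a, b and d computed from the strings and k. *)
Definition computable_real_fun2 (R : realType)
    (f : seq bool -> seq bool -> R) : Prop :=
  exists ca cb cd : mu_code, forall (x y : seq bool) (k : nat),
    exists a b d : nat,
      [/\ mu_eval ca [:: string_code x; string_code y; k] a,
          mu_eval cb [:: string_code x; string_code y; k] b,
          mu_eval cd [:: string_code x; string_code y; k] d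
        & `|f x y - (a%:R - b%:R) / d.+1%:R| <= 2 ^- k].

(* Cantor space with its Borel sigma-algebra. *)
Notation cantor := (g_sigma_algebraType (@open cantor_space)).

Definition cylinder (x : seq bool) : set cantor :=
  [set a : cantor | mkseq a (size x) = x].

Definition computable_measure2 (R : realType)
    (P : {measure set (cantor * cantor)%type -> \bar R}) : Prop :=
  computable_real_fun2
    (fun x y : seq bool => fine (P (cylinder x `*` cylinder y))).

(* A set of tuples of strings is recursively enumerable when it is the domain
   of a mu-recursive partial function. *)
Definition unif_eff_open (V : nat -> set cantor) : Prop :=
  exists c : mu_code, forall n : nat,
    V n = \bigcup_(x in [set x | mu_halts c [:: n; string_code x]])
            cylinder x.

Definition unif_eff_open2 (V : nat -> set (cantor * cantor)) : Prop :=
  exists c : mu_code, forall n : nat,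
    V n = \bigcup_(xy in [set xy : seq bool * seq bool |
              mu_halts c [:: n; string_code xy.1; string_code xy.2]])
            (cylinder xy.1 `*` cylinder xy.2).

Definition ml_test (R : realType) (Q : {measure set cantor -> \bar R})
    (V : nat -> set cantor) : Prop :=
  unif_eff_open V /\ forall n : nat, (Q (V n) <= (2 ^- n)%:E)%E.

(* Blind (Hippocratic) randomness: tests get no oracle access to [Q]. *)
Definition ml_random (R : realType) (Q : {measure set cantor -> \bar R})
    (a : cantor) : Prop :=
  forall V : nat -> set cantor, ml_test Q V -> ~ (\bigcap_n V n) a.

Definition ml_test2 (R : realType)
    (P : {measure set (cantor * cantor)%type -> \bar R})
    (V : nat -> set (cantor * cantor)) : Prop :=
  unif_eff_open2 V /\ forall n : nat, (P (V n) <= (2 ^- n)%:E)%E.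

Definition ml_random2 (R : realType)
    (P : {measure set (cantor * cantor)%type -> \bar R})
    (ab : cantor * cantor) : Prop :=
  forall V : nat -> set (cantor * cantor),
    ml_test2 P V -> ~ (\bigcap_n V n) ab.

Definition cond_ratio (R : realType)
    (P : probability (cantor * cantor)%type R) (b : cantor) (S : set cantor)
    (n : nat) : R :=
  fine (P (S `*` cylinder (mkseq b n))) /
  fine (P ([set: cantor] `*` cylinder (mkseq b n))).

(* [Q] is the conditional measure P_C( . | b): all the limits defining it exist
   and it is a probability measure.  As Q(2^N) = 1, the convention x / 0 = 0
   plays no role: the denominators (which decrease with n) are all nonzero. *)
Definition is_conditional_measure (R : realType)
    (P : probability (cantor * cantor)%type R) (b : cantor)
    (Q : probability cantor R) : Prop :=
  forall S : set cantor, measurable S ->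
    cond_ratio P b S n @[n --> \oo] --> fine (Q S).

(* Main.v *)
Require Import Defs.
From HB Require Import structures.
From mathcomp Require Import all_boot all_order all_algebra.
From mathcomp Require Import all_classical all_reals all_analysis.
From mathcomp Require Import zify lra.

(** Let [B] be a computable set of strings generating a universal open set [U]
    of uniform measure at most 1/2: [U] contains every sequence that fails some
    Martin-Loef test for the uniform measure [lam].  Draw [u] uniformly, and let
    [y u] record at position [n] whether the prefix of [u] of length [n] is in
    [B]; [P] is the law of [(u, y u)], which is computable because [B] is.

    Take [beta = 000...].  Conditioning on [y u] extending [0^n] means that [u]
    has not been seen in [U] before stage [n], so the conditional measures
    converge to [lam] conditioned on the complement of [U].  Let [alpha] be the
    leftmost sequence outside [U].  It is [lam]-random, and since [P] gives
    [[x] x [0^m]] the uniform measure of the part of [x] not seen in [U] before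
    stage [m], a [P]-test failed by [(alpha, beta)] would yield a [lam]-test
    failed by [alpha].  But [alpha] can be approximated from the left: a string
    [w] of length [n + 1] such that everything to the left of [w] is seen to be
    covered by [U] is either the prefix of [alpha] or itself inside [U].  Those
    strings form an effectively open neighbourhood of [alpha] whose measure
    outside [U] is at most [2 ^- (n + 1)], hence a test failed by [alpha]. *)

Set Implicit Arguments.
Unset Strict Implicit.
Unset Printing Implicit Defensive.

(** * Recursive functions *)

(** The arguments of [MComp] sit in a list, so the recursion is written by hand; the [foldr] gives
    one hypothesis for each code of that list. *)
Lemma mu_code_nested_ind (P : mu_code -> Prop) :
  P MZero -> P MSucc -> (forall i, P (MProj i)) ->
  (forall f gs, P f -> foldr (fun g Q => P g /\ Q) True gs ->
    P (MComp f gs)) ->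
  (forall f g, P f -> P g -> P (MPrec f g)) ->
  (forall f, P f -> P (MMin f)) ->
  forall c, P c.
Proof.
move=> P0 PS Pp Pc Pr Pm; fix IH 1; case.
- exact: P0.
- exact: PS.
- exact: Pp.
- move=> f gs; apply: Pc; first exact: IH.
  elim: gs => [|g gs IHgs]; [exact: I|split; [exact: IH|exact: IHgs]].
- move=> f g; apply: Pr; exact: IH.
- move=> f; apply: Pm; exact: IH.
Qed.

(** A named copy of the anonymous inner fixpoint of [mu_eval], convertible to it. *)
Definition mu_evals (xs : seq nat) :=
  fix values (gs : seq mu_code) (ys : seq nat) {struct gs} : Prop :=
    match gs, ys with
    | [::], [::] => True
    | g :: gs', z :: ys' => mu_eval g xs z /\ values gs' ys'
    | _, _ => False
    end.

Lemma mu_eval_comp f gs xs y :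
  mu_eval (MComp f gs) xs y <->
  exists2 ys, mu_evals xs gs ys & mu_eval f ys y.
Proof. by [].
Qed.

Lemma mu_eval_prec0 f g xs y :
  mu_eval (MPrec f g) (0%N :: xs) y <-> mu_eval f xs y.
Proof. by []. Qed.

Lemma mu_eval_precS f g n xs y :
  mu_eval (MPrec f g) (n.+1 :: xs) y <->
  exists2 w, mu_eval (MPrec f g) (n :: xs) w & mu_eval g [:: n, w & xs] y.
Proof. by []. Qed.

(** Codes carry no arity, so the length of the arguments is fixed here. Predicates are covered
    through the coercion of [bool] to [nat]. *)
Definition recursive (n : nat) (f : seq nat -> nat) : Prop :=
  exists c, forall xs, size xs = n -> forall y, mu_eval c xs y <-> y = f xs.

Lemma eq_recursive n f g :
  (forall xs, size xs = n -> f xs = g xs) -> recursive n f -> recursive n g.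
Proof. by move=> e [c cf]; exists c => xs sxs y; rewrite cf // e. Qed.

Lemma recursive_comp n F (gs : seq (seq nat -> nat)) :
  recursive (size gs) F -> foldr (fun g Q => recursive n g /\ Q) True gs ->
  recursive n (fun xs => F [seq g xs | g <- gs]).
Proof.
move=> [c cF] Hgs.
have [cs [scs Hcs]] : exists cs : seq mu_code, size cs = size gs /\
    forall xs, size xs = n -> forall ys,
      mu_evals xs cs ys <-> ys = [seq g xs | g <- gs].
  elim: gs Hgs {cF} => [|g gs IH] /=.
    by move=> _; exists [::]; split=> // xs sxs [|].
  move=> [[d dg] /IH[cs [scs Hcs]]]; exists (d :: cs); split=> /=.
    by rewrite scs.
  move=> xs sxs [|y ys] //; rewrite (dg _ sxs) (Hcs _ sxs).
  by split=> [[-> ->]|[-> ->]].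
exists (MComp c cs) => xs sxs y; rewrite mu_eval_comp; split.
  by move=> [ys /(Hcs _ sxs) -> /cF ->]; rewrite ?size_map.
move=> ->; exists [seq g xs | g <- gs]; first exact/Hcs.
by apply/cF; rewrite ?size_map.
Qed.

Definition recursive1 F := recursive 1 (fun xs => F (nth 0 xs 0)).
Definition recursive2 F := recursive 2 (fun xs => F (nth 0 xs 0) (nth 0 xs 1)).
Definition recursive3 F :=
  recursive 3 (fun xs => F (nth 0 xs 0) (nth 0 xs 1) (nth 0 xs 2)).

Lemma recursive_comp1 F n f : recursive1 F -> recursive n f ->
  recursive n (fun xs => F (f xs)).
Proof. by move=> hF hf; exact: (@recursive_comp n (fun xs => F (nth 0 xs 0))
  [:: f]). Qed.

Lemma recursive_comp2 F n f g : recursive2 F ->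
  recursive n f -> recursive n g -> recursive n (fun xs => F (f xs) (g xs)).
Proof.
move=> hF hf hg.
exact: (@recursive_comp n (fun xs => F (nth 0 xs 0) (nth 0 xs 1)) [:: f; g]).
Qed.

Lemma recursive_comp3 F n f g h : recursive3 F ->
  recursive n f -> recursive n g -> recursive n h ->
  recursive n (fun xs => F (f xs) (g xs) (h xs)).
Proof.
move=> hF hf hg hh.
by apply: (@recursive_comp n
  (fun xs => F (nth 0 xs 0) (nth 0 xs 1) (nth 0 xs 2)) [:: f; g; h]).
Qed.

(** Bounded quantifiers and recursions read their parameters through iterated [behead]; [shift] lets
    a single projection lemma serve at every depth. *)
Definition shift (h : seq nat -> seq nat) := exists k, h =1 drop k.

Lemma shift0 : shift (fun xs => xs).
Proof. by exists 0 => xs; rewrite drop0. Qed.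

Lemma shiftS h : shift h -> shift (fun xs => behead (h xs)).
Proof.
by move=> [k hk]; exists k.+1 => xs; rewrite hk -drop1 drop_drop add1n.
Qed.

Lemma recursive_nth h n i : shift h -> recursive n (fun xs => nth 0 (h xs) i).
Proof.
by move=> [k hk]; exists (MProj (k + i)) => xs _ y; rewrite hk nth_drop.
Qed.

Lemma recursive_const n k : recursive n (fun=> k).
Proof.
elim: k => [|k [c ck]]; first by exists MZero => xs _ y.
exists (MComp MSucc [:: c]) => xs sxs y; rewrite mu_eval_comp; split.
  by move=> [[|z [|z' ys]] //=] [/(ck _ sxs) -> _].
by move=> ->; exists [:: k] => //=; split=> //; apply/ck.
Qed.

(** [MPrec] recurses on the head of its arguments. The recursion is therefore built with one extra
    leading argument, into which [b] is then substituted. *)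
Lemma recursive_prec n f h b : recursive n f ->
  recursive n.+2 (fun xs => h (nth 0 xs 0) (nth 0 xs 1) (behead (behead xs))) ->
  recursive n b ->
  recursive n (fun xs => nat_rect (fun=> nat) (f xs) (fun m w => h m w xs) (b
    xs)).
Proof.
move=> [c cf] [d dh] rb.
have rG : recursive n.+1 (fun xs => nat_rect (fun=> nat) (f (behead xs))
    (fun m w => h m w (behead xs)) (nth 0 xs 0)).
  exists (MPrec c d) => -[|m xs] // [sxs] y; rewrite [behead _]/= [nth _ _ _]/=.
  elim: m y => [|m IH] y; first by rewrite mu_eval_prec0 cf.
  rewrite mu_eval_precS; split.
    by move=> [w /IH -> /dh ->] /=; rewrite ?sxs.
  by move=> ->; eexists; [apply/IH|apply/dh; rewrite //= sxs].
(* Composing with [b] followed by all the projections passes the list [b xs :: xs]. *)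
pose ps := [seq (fun xs => nth 0 xs i) | i <- iota 0 n].
have := @recursive_comp n _ (b :: ps); rewrite /= size_map size_iota.
move=> /(_ _ rG) H; apply: eq_recursive (H _); last first.
  split=> //; rewrite /ps; elim: (iota 0 n) => //= i s IH; split=> //.
  exact: recursive_nth shift0.
move=> xs sxs /=; suff -> : [seq g xs | g <- ps] = xs by [].
rewrite /ps -map_comp -[RHS](mkseq_nth 0) sxs.
by [].
Qed.

(** * Closure of the recursive functions under arithmetic and Boolean operations *)

Lemma recursive_S : recursive1 S.
Proof. by exists MSucc => -[|x xs] //= _ y. Qed.

Create HintDb rec.
#[local] Hint Resolve shift0 shiftS recursive_nth recursive_const : rec.
Ltac rec := solve [auto 200 with rec nocore].

Lemma recursiveS n f : recursive n f -> recursive n (fun xs => (f xs).+1).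
Proof. exact: recursive_comp1 recursive_S. Qed.
#[local] Hint Resolve recursiveS : rec.

Lemma recursiveP n f : recursive n f -> recursive n (fun xs => (f xs).-1).
Proof.
apply: (@recursive_comp1 predn); apply: eq_recursive (@recursive_prec 1 (fun=>
  0)
  (fun m _ _ => m) (fun xs => nth 0 xs 0) _ _ _); try rec.
by move=> xs _ /=; case: (nth 0 xs 0).
Qed.
#[local] Hint Resolve recursiveP : rec.

Lemma recursiveD n f g : recursive n f -> recursive n g ->
  recursive n (fun xs => f xs + g xs).
Proof.
apply: (@recursive_comp2 addn); apply: eq_recursive (@recursive_prec 2
  (fun xs => nth 0 xs 0) (fun _ w _ => w.+1) (fun xs => nth 0 xs 1) _ _ _);
    try rec.
by move=> xs _ /=; elim: (nth 0 xs 1) => [|k /= ->] /=; lia.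
Qed.

Lemma recursiveB n f g : recursive n f -> recursive n g ->
  recursive n (fun xs => f xs - g xs).
Proof.
apply: (@recursive_comp2 subn); apply: eq_recursive (@recursive_prec 2
  (fun xs => nth 0 xs 0) (fun _ w _ => w.-1) (fun xs => nth 0 xs 1) _ _ _);
    try rec.
by move=> xs _ /=; elim: (nth 0 xs 1) => [|k /= ->] /=; lia.
Qed.
#[local] Hint Resolve recursiveD recursiveB : rec.

Lemma recursiveM n f g : recursive n f -> recursive n g ->
  recursive n (fun xs => f xs * g xs).
Proof.
apply: (@recursive_comp2 muln); apply: eq_recursive (@recursive_prec 2
  (fun=> 0) (fun _ w xs => w + nth 0 xs 0) (fun xs => nth 0 xs 1) _ _ _);
    try rec.
by move=> xs _ /=; elim: (nth 0 xs 1) => [|k /= ->] /=; lia.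
Qed.
#[local] Hint Resolve recursiveM : rec.

Lemma recursiveX2 n f : recursive n f -> recursive n (fun xs => 2 ^ f xs).
Proof.
apply: (@recursive_comp1 (expn 2)); apply: eq_recursive (@recursive_prec 1
  (fun=> 1) (fun _ w _ => 2 * w) (fun xs => nth 0 xs 0) _ _ _); try rec.
by move=> xs _ /=; elim: (nth 0 xs 0) => [|k /= ->] //; rewrite expnS.
Qed.

Lemma recursive_leq n f g : recursive n f -> recursive n g ->
  recursive n (fun xs => f xs <= g xs).
Proof.
move=> rf rg; apply: (@eq_recursive n (fun xs => 1 - (f xs - g xs)));
  last by rec.
by move=> xs _; lia.
Qed.
#[local] Hint Resolve recursiveX2 recursive_leq : rec.

Lemma recursive_and n (f g : seq nat -> bool) : recursive n f ->
  recursive n g ->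
  recursive n (fun xs => f xs && g xs).
Proof.
move=> rf rg; apply: (@eq_recursive n (fun xs => f xs * g xs)); last by rec.
by move=> xs _; lia.
Qed.

Lemma recursive_neg n (f : seq nat -> bool) : recursive n f ->
  recursive n (fun xs => ~~ f xs).
Proof.
move=> rf; apply: (@eq_recursive n (fun xs => 1 - f xs)); last by rec.
by move=> xs _; lia.
Qed.
#[local] Hint Resolve recursive_and recursive_neg : rec.

Lemma recursive_or n (f g : seq nat -> bool) : recursive n f -> recursive n g ->
  recursive n (fun xs => f xs || g xs).
Proof.
move=> rf rg; apply: (@eq_recursive n (fun xs => ~~ (~~ f xs && ~~ g xs))).
  by move=> xs _; lia.
by rec.
Qed.

Lemma recursive_imply n (f g : seq nat -> bool) : recursive n f ->
  recursive n g -> recursive n (fun xs => f xs ==> g xs).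
Proof.
move=> rf rg; apply: (@eq_recursive n (fun xs => ~~ (f xs && ~~ g xs))).
  by move=> xs _; lia.
by rec.
Qed.

Lemma recursive_eq n f g : recursive n f -> recursive n g ->
  recursive n (fun xs => f xs == g xs).
Proof.
move=> rf rg.
apply: (@eq_recursive n (fun xs => (f xs <= g xs) && (g xs <= f xs))).
  by move=> xs _; lia.
by rec.
Qed.
#[local] Hint Resolve recursive_or recursive_imply recursive_eq : rec.

Lemma recursive_eqb n (f g : seq nat -> bool) : recursive n f ->
  recursive n g -> recursive n (fun xs => f xs == g xs).
Proof.
move=> rf rg; apply: (@eq_recursive n (fun xs => nat_of_bool (f xs) == g xs)).
  by move=> xs _; lia.
by rec.
Qed.

Lemma recursive_if n (b : seq nat -> bool) (f g : seq nat -> bool) :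
  recursive n b -> recursive n f -> recursive n g ->
  recursive n (fun xs => if b xs then f xs else g xs).
Proof.
move=> rb rf rg.
apply: (@eq_recursive n (fun xs => b xs && f xs || ~~ b xs && g xs)).
  by move=> xs _; case: (b xs); rewrite ?orbF.
by rec.
Qed.
#[local] Hint Resolve recursive_eqb recursive_if : rec.

Lemma recursive_iter n h f b : recursive1 h -> recursive n f ->
  recursive n b -> recursive n (fun xs => iter (b xs) h (f xs)).
Proof.
move=> rh rf rb; apply: eq_recursive (@recursive_prec n f (fun _ w _ => h w) b
  rf _ rb).
  by move=> xs _; elim: (b xs) => //= k ->.
by apply: recursive_comp1 => //; rec.
Qed.

(** Counting is the basic operation: it yields both bounded quantifiers, the integer square root,
    the length of a string and the measure of clopen sets. *)
Definition cntb (b : nat) (P : pred nat) := count P (iota 0 b).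
Definition exb (b : nat) (P : pred nat) := has P (iota 0 b).
Definition allb (b : nat) (P : pred nat) := all P (iota 0 b).

Lemma exbP b (P : pred nat) : reflect (exists2 i, i < b & P i) (exb b P).
Proof.
apply: (iffP hasP) => -[i]; last by exists i; rewrite // mem_iota.
by rewrite mem_iota; exists i.
Qed.

Lemma allbP b (P : pred nat) : reflect (forall i, i < b -> P i) (allb b P).
Proof.
apply: (iffP allP) => H i; first by move=> ib; apply: H; rewrite mem_iota.
by rewrite mem_iota => /andP[_ ib]; exact: H.
Qed.

Lemma cntbS b (P : pred nat) : cntb b.+1 P = cntb b P + P b.
Proof. by rewrite /cntb -addn1 iotaD count_cat /= addn0. Qed.

Lemma recursive_drop k n f :
  recursive n f -> recursive (k + n) (fun xs => f (drop k xs)).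
Proof.
move=> rf; pose ps := [seq (fun xs => nth 0 xs i) | i <- iota k n].
have sps : size ps = n by rewrite size_map size_iota.
rewrite -sps in rf; apply: eq_recursive (@recursive_comp (k + n) _ ps rf _).
  move=> xs sxs; congr f; rewrite -map_comp -[RHS](mkseq_nth 0) size_drop sxs.
  rewrite addKn /mkseq -[k in iota k]addn0 iotaDl -map_comp.
  by apply: eq_map => i /=; rewrite nth_drop.
by rewrite /ps; elim: (iota k n) => //= i s IH; split=> //; rec.
Qed.

Lemma recursive_behead n f :
  recursive n f -> recursive n.+1 (fun xs => f (behead xs)).
Proof.
by move=> /(recursive_drop 1); apply: eq_recursive => xs _; rewrite drop1.
Qed.

Lemma recursive_cntb n (P : nat -> seq nat -> bool) b :
  recursive n.+1 (fun xs => P (nth 0 xs 0) (behead xs)) -> recursive n b ->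
  recursive n (fun xs => cntb (b xs) (fun i => P i xs)).
Proof.
move=> rP rb; apply: eq_recursive (@recursive_prec n (fun=> 0)
  (fun m w xs => w + P m xs) b _ _ rb).
- by move=> xs _; elim: (b xs) => //= k ->; rewrite cntbS.
- by rec.
- apply: recursiveD; first by rec.
  (* The recursor supplies the index, the accumulator and the parameters; these projections skip the
     accumulator, at position 1. *)
  pose ps := [seq (fun xs => nth 0 xs i) | i <- 0 :: iota 2 n].
  have sps : size ps = n.+1 by rewrite /= size_map size_iota.
  rewrite -sps in rP; apply: eq_recursive (@recursive_comp n.+2 _ ps rP _).
    move=> [|x [|y xs]] //= [sxs]; congr (P _ _ : nat).
    rewrite -map_comp -[RHS](mkseq_nth 0) sxs /mkseq.
    by rewrite (iotaDl 2 0) -map_comp.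
  by rewrite /ps; elim: (0 :: iota 2 n) => //= i s IH; split=> //; rec.
Qed.
#[local] Hint Resolve recursive_cntb : rec.

Lemma recursive_exb n (P : nat -> seq nat -> bool) b :
  recursive n.+1 (fun xs => P (nth 0 xs 0) (behead xs)) -> recursive n b ->
  recursive n (fun xs => exb (b xs) (fun i => P i xs)).
Proof.
move=> rP rb.
apply: (@eq_recursive n (fun xs => 0 < cntb (b xs) (fun i => P i xs))).
  by move=> xs _; rewrite /exb has_count.
by rec.
Qed.

Lemma recursive_allb n (P : nat -> seq nat -> bool) b :
  recursive n.+1 (fun xs => P (nth 0 xs 0) (behead xs)) -> recursive n b ->
  recursive n (fun xs => allb (b xs) (fun i => P i xs)).
Proof.
move=> rP rb.
apply: (@eq_recursive n (fun xs => cntb (b xs) (fun i => P i xs) == b xs)).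
  by move=> xs _; rewrite /allb all_count size_iota.
by rec.
Qed.
#[local] Hint Resolve recursive_exb recursive_allb : rec.

(** * A universal recursive predicate *)

(** As [a <= a + b], this number lies between the squares of [a + b] and of its successor, so an
    integer square root recovers [a + b], then [a] and [b]. *)
Definition npair a b := (a + b) ^ 2 + a.
Definition nsqrt z := cntb z (fun i => i.+1 ^ 2 <= z).
Definition nfst z := z - nsqrt z ^ 2.
Definition nsnd z := nsqrt z - nfst z.

Lemma nsqrt_npair a b : nsqrt (npair a b) = a + b.
Proof.
set s := a + b; have le_s : s <= npair a b by rewrite /npair -/s; nia.
rewrite /nsqrt /cntb -(subnKC le_s) iotaD count_cat add0n.
rewrite -[RHS]addn0; congr (_ + _).
  rewrite -[RHS](size_iota 0); apply/eqP; rewrite -all_count.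
  apply/allP => i; rewrite mem_iota /npair -/s => /andP[_ lt_is].
  by rewrite subnKC //; nia.
apply/eqP; rewrite -leqn0 leqNgt -has_count; apply/hasPn => i.
by rewrite mem_iota subnKC // /npair -/s -ltnNge => /andP[le_si _]; nia.
Qed.

Lemma nfst_npair a b : nfst (npair a b) = a.
Proof. by rewrite /nfst nsqrt_npair /npair; lia. Qed.

Lemma nsnd_npair a b : nsnd (npair a b) = b.
Proof. by rewrite /nsnd nsqrt_npair nfst_npair; lia. Qed.

(** The successor keeps 0 free to code the empty list, whose head and tail then also come out as 0,
    in accordance with the default values of [head] and [nth]. *)
Definition ncons a l := (npair a l).+1.
Definition nhd l := nfst l.-1.
Definition ntl l := nsnd l.-1.
Definition nnth l i := nhd (iter i ntl l).
Definition ncode := foldr ncons 0.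

Lemma nhd_cons a l : nhd (ncons a l) = a. Proof. exact: nfst_npair. Qed.
Lemma ntl_cons a l : ntl (ncons a l) = l. Proof. exact: nsnd_npair. Qed.

Lemma nhd_code xs : nhd (ncode xs) = head 0 xs.
Proof. by case: xs => //= x xs; rewrite nhd_cons. Qed.

Lemma ntl_code xs : ntl (ncode xs) = ncode (behead xs).
Proof. by case: xs => //= x xs; rewrite ntl_cons. Qed.

Lemma nnth_code xs i : nnth (ncode xs) i = nth 0 xs i.
Proof.
rewrite /nnth; elim: i xs => [|i IH] xs; first by rewrite nhd_code nth0.
by rewrite iterSr ntl_code IH nth_behead.
Qed.

Lemma recursiveX n f k : recursive n f -> recursive n (fun xs => f xs ^ k).
Proof.
move=> rf; elim: k => [|k IH]; first exact: recursive_const.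
apply: (@eq_recursive n (fun xs => f xs * f xs ^ k)); last by rec.
by move=> xs _; rewrite expnS.
Qed.
#[local] Hint Resolve recursiveX : rec.

Lemma recursive_npair n f g : recursive n f -> recursive n g ->
  recursive n (fun xs => npair (f xs) (g xs)).
Proof. by move=> rf rg; rewrite /npair; rec. Qed.

Lemma recursive_nsqrt n f :
  recursive n f -> recursive n (fun xs => nsqrt (f xs)).
Proof.
by apply: (@recursive_comp1 nsqrt); rewrite /recursive1 /nsqrt; rec.
Qed.
#[local] Hint Resolve recursive_npair recursive_nsqrt : rec.

Lemma recursive_nfst n f : recursive n f -> recursive n (fun xs => nfst (f xs)).
Proof. by move=> rf; rewrite /nfst; rec. Qed.
#[local] Hint Resolve recursive_nfst : rec.

Lemma recursive_nsnd n f : recursive n f -> recursive n (fun xs => nsnd (f xs)).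
Proof. by move=> rf; rewrite /nsnd; rec. Qed.
#[local] Hint Resolve recursive_nsnd : rec.

Lemma recursive_nhd n f : recursive n f -> recursive n (fun xs => nhd (f xs)).
Proof. by move=> rf; rewrite /nhd; rec. Qed.

Lemma recursive_ntl n f : recursive n f -> recursive n (fun xs => ntl (f xs)).
Proof. by move=> rf; rewrite /ntl; rec. Qed.

Lemma recursive_ncons n f g : recursive n f -> recursive n g ->
  recursive n (fun xs => ncons (f xs) (g xs)).
Proof. by move=> rf rg; rewrite /ncons; rec. Qed.
#[local] Hint Resolve recursive_nhd recursive_ntl recursive_ncons : rec.

Lemma recursive_nnth n f g : recursive n f -> recursive n g ->
  recursive n (fun xs => nnth (f xs) (g xs)).
Proof.
move=> rf rg; apply: recursive_nhd; apply: recursive_iter => //.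
by rewrite /recursive1; rec.
Qed.
#[local] Hint Resolve recursive_nnth : rec.

(** The leading entry is a tag naming the constructor; [step_eval] dispatches on it. *)
Fixpoint mu_code_num (c : mu_code) : nat :=
  match c with
  | MZero => ncode [:: 0]
  | MSucc => ncode [:: 1]
  | MProj i => ncode [:: 2; i]
  | MComp f gs => ncode [:: 3; mu_code_num f; ncode (map mu_code_num gs)]
  | MPrec f g => ncode [:: 4; mu_code_num f; mu_code_num g]
  | MMin f => ncode [:: 5; mu_code_num f]
  end.

(* The three judgements of the evaluation calculus: [c] maps [X] to [y]; the
   codes listed in [G] map [X] to the values listed in [Y]; [f] is positive on
   [m :: X] for all [m < k]. *)
Definition j_eval c X y := ncons 1 (ncons c (ncons X (ncons y 0))).
Definition j_evals G X Y := ncons 2 (ncons G (ncons X (ncons Y 0))).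
Definition j_below f X k := ncons 3 (ncons f (ncons X (ncons k 0))).

(** [A] and [B] are the premises. An intermediate value that the conclusion does not determine is
    read off the first premise as [nnth A 3], which avoids any existential quantifier. *)
Definition step_eval c X y A B :=
  let k := nnth c 0 in let f := nnth c 1 in let g := nnth c 2 in
  [|| (k == 0) && (y == 0),
      (k == 1) && (y == (nhd X).+1),
      (k == 2) && (y == nnth X f),
      (k == 3) && ((A == j_evals g X (nnth A 3)) && (B == j_eval f (nnth A 3)
        y)),
      (k == 4) && (if nhd X == 0 then A == j_eval f (ntl X) y else
        (A == j_eval c (ncons (nhd X).-1 (ntl X)) (nnth A 3)) &&
        (B == j_eval g (ncons (nhd X).-1 (ncons (nnth A 3) (ntl X))) y))
    | (k == 5) && ((A == j_below f X y) && (B == j_eval f (ncons y X) 0))].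

Definition step_evals G X Y A B :=
  if G == 0 then Y == 0 else
  (Y == ncons (nhd Y) (ntl Y)) &&
  ((A == j_eval (nhd G) X (nhd Y)) && (B == j_evals (ntl G) X (ntl Y))).

Definition step_below f X k A B :=
  (k == 0) || (A == j_below f X k.-1) &&
  ((B == j_eval f (ncons k.-1 X) (nnth B 3)) && (0 < nnth B 3)).

(* [step J A B]: the judgement [J] follows from [A] and [B] by one rule; a rule
   with fewer than two premises does not constrain the others. *)
Definition step J A B :=
  [|| (nnth J 0 == 1) && step_eval (nnth J 1) (nnth J 2) (nnth J 3) A B,
      (nnth J 0 == 2) && step_evals (nnth J 1) (nnth J 2) (nnth J 3) A B
    | (nnth J 0 == 3) && step_below (nnth J 1) (nnth J 2) (nnth J 3) A B].

Lemma recursive_step : recursive3 step.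
Proof.
rewrite /recursive3 /step; apply: recursive_or; [|apply: recursive_or];
  apply: recursive_and; try rec.
- rewrite /step_eval /j_eval /j_evals /j_below; cbv zeta.
  do 5 (apply: recursive_or; [by rec|]); rec.
- rewrite /step_evals /j_eval /j_evals; rec.
- rewrite /step_below /j_eval /j_below; rec.
Qed.

(** The number 0 stands for an absent premise; it is no judgement, since [step 0] is always
    false. *)
Inductive derivable (J : nat) : Prop :=
  Derivable A B of step J A B & A = 0 \/ derivable A & B = 0 \/ derivable B.

(** * Inversion of the rules, constructor by constructor *)

Lemma step0 A B : step 0 A B = false. Proof. by []. Qed.

Section StepEval.
Variables (f g X y A B : nat).

Lemma step_evalE c : step (j_eval c X y) A B = step_eval c X y A B.
Proof. by rewrite /step /nnth /= !(nhd_cons, ntl_cons) /= orbF. Qed.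

Lemma step_zero : step (j_eval (ncode [:: 0]) X y) A B = (y == 0).
Proof. by rewrite step_evalE /step_eval !nnth_code /= orbF. Qed.

Lemma step_succ : step (j_eval (ncode [:: 1]) X y) A B = (y == (nhd X).+1).
Proof. by rewrite step_evalE /step_eval !nnth_code /= orbF. Qed.

Lemma step_proj : step (j_eval (ncode [:: 2; f]) X y) A B = (y == nnth X f).
Proof. by rewrite step_evalE /step_eval !nnth_code /= orbF. Qed.

Lemma step_comp : step (j_eval (ncode [:: 3; f; g]) X y) A B =
  (A == j_evals g X (nnth A 3)) && (B == j_eval f (nnth A 3) y).
Proof. by rewrite step_evalE /step_eval !nnth_code /= orbF. Qed.

Lemma step_prec (c := ncode [:: 4; f; g]) : step (j_eval c X y) A B =
  if nhd X == 0 then A == j_eval f (ntl X) y else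
  (A == j_eval c (ncons (nhd X).-1 (ntl X)) (nnth A 3)) &&
  (B == j_eval g (ncons (nhd X).-1 (ncons (nnth A 3) (ntl X))) y).
Proof. by rewrite step_evalE /step_eval !nnth_code /= orbF. Qed.

Lemma step_min : step (j_eval (ncode [:: 5; f]) X y) A B =
  (A == j_below f X y) && (B == j_eval f (ncons y X) 0).
Proof. by rewrite step_evalE /step_eval !nnth_code. Qed.

End StepEval.

Lemma step_evalsE G X Y A B : step (j_evals G X Y) A B = step_evals G X Y A B.
Proof.
by rewrite /step /nnth /= !(nhd_cons, ntl_cons) /= orbF.
Qed.

Lemma step_belowE f X k A B : step (j_below f X k) A B = step_below f X k A B.
Proof.
by rewrite /step /nnth /= !(nhd_cons, ntl_cons) /=.
Qed.

Lemma derivable_neq0 : ~ derivable 0.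
Proof. by case=> A B; rewrite step0. Qed.

Lemma derivable_premise A a l :
  A = ncons a l -> A = 0 \/ derivable A -> derivable (ncons a l).
Proof. by move=> -> []. Qed.

Lemma nnth_j_evals G X Y : nnth (j_evals G X Y) 3 = Y.
Proof. by rewrite /nnth /= !(nhd_cons, ntl_cons). Qed.

Lemma nnth_j_eval c X y : nnth (j_eval c X y) 3 = y.
Proof. by rewrite /nnth /= !(nhd_cons, ntl_cons). Qed.

Lemma derivable_comp f gs X y :
  derivable (j_eval (mu_code_num (MComp f gs)) X y) <->
  exists Y, derivable (j_evals (ncode (map mu_code_num gs)) X Y) /\
            derivable (j_eval (mu_code_num f) Y y).
Proof.
split=> [[A B]|[Y [dA dB]]].
  rewrite step_comp => /andP[/eqP eA /eqP eB] dA dB.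
  by exists (nnth A 3); split; [exact: derivable_premise dA|exact:
    derivable_premise dB].
apply: (Derivable _ (or_intror dA) (or_intror dB)).
by rewrite step_comp nnth_j_evals !eqxx.
Qed.

Lemma derivable_prec0 f g X y : nhd X = 0 ->
  derivable (j_eval (mu_code_num (MPrec f g)) X y) <->
  derivable (j_eval (mu_code_num f) (ntl X) y).
Proof.
move=> X0; split=> [[A B]|dA].
  rewrite step_prec X0 => /eqP eA dA _.
  exact: derivable_premise dA.
apply: (Derivable (B := 0) _ (or_intror dA) (or_introl _)) => //.
by rewrite step_prec X0 !eqxx.
Qed.

Lemma derivable_precS f g n X y : nhd X = n.+1 ->
  derivable (j_eval (mu_code_num (MPrec f g)) X y) <->
  exists w, derivable (j_eval (mu_code_num (MPrec f g)) (ncons n (ntl X)) w) /\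
    derivable (j_eval (mu_code_num g) (ncons n (ncons w (ntl X))) y).
Proof.
move=> Xn; split=> [[A B]|[w [dA dB]]].
  rewrite step_prec Xn => /andP[/eqP eA /eqP eB] dA dB.
  by exists (nnth A 3); split; [exact: derivable_premise dA|exact:
    derivable_premise dB].
apply: (Derivable _ (or_intror dA) (or_intror dB)).
by rewrite step_prec Xn nnth_j_eval !eqxx.
Qed.

Lemma derivable_min f X y :
  derivable (j_eval (mu_code_num (MMin f)) X y) <->
  derivable (j_below (mu_code_num f) X y) /\
  derivable (j_eval (mu_code_num f) (ncons y X) 0).
Proof.
split=> [[A B]|[dA dB]].
  rewrite step_min => /andP[/eqP eA /eqP eB] dA dB.
  by split; [exact: derivable_premise dA|exact: derivable_premise dB].
apply: (Derivable _ (or_intror dA) (or_intror dB)).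
by rewrite step_min !eqxx.
Qed.

Lemma derivable_axiom J : step J 0 0 -> derivable J.
Proof. by move=> sJ; apply: Derivable sJ _ _; left. Qed.

Lemma derivable_nil X Y : derivable (j_evals 0 X Y) <-> Y = 0.
Proof.
split=> [[A B]|->]; first by rewrite step_evalsE => /eqP.
by apply: derivable_axiom; rewrite step_evalsE.
Qed.

Lemma derivable_evals_cons g G X Y : derivable (j_evals (ncons g G) X Y) <->
  exists z Z, [/\ Y = ncons z Z, derivable (j_eval g X z) &
                  derivable (j_evals G X Z)].
Proof.
split=> [[A B]|[z [Z [-> dA dB]]]].
  rewrite step_evalsE /step_evals /= nhd_cons ntl_cons.
  move=> /and3P[/eqP eY /eqP eA /eqP eB] dA dB.
  exists (nhd Y), (ntl Y).
  by split=> //; [exact: derivable_premise dA|exact: derivable_premise dB].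
apply: (Derivable _ (or_intror dA) (or_intror dB)).
by rewrite step_evalsE /step_evals /= !(nhd_cons, ntl_cons) !eqxx.
Qed.

Lemma derivable_below0 f X : derivable (j_below f X 0).
Proof. by apply: derivable_axiom; rewrite step_belowE. Qed.

Lemma derivable_belowS f X k : derivable (j_below f X k.+1) <->
  derivable (j_below f X k) /\ exists z, derivable (j_eval f (ncons k X) z.+1).
Proof.
split=> [[A B]|[dA [z dB]]].
  rewrite step_belowE /step_below /=.
  move=> /and3P[/eqP eA /eqP eB zB] dA dB.
  split; first exact: derivable_premise dA.
  by exists (nnth B 3).-1; rewrite prednK //; exact: derivable_premise dB.
apply: (Derivable _ (or_intror dA) (or_intror dB)).
by rewrite step_belowE /step_below /= nnth_j_eval !eqxx.
Qed.

(** The rules mirror the clauses of [mu_eval], by induction on the code, with inner inductions on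
    the list of codes for [MComp], on the recursion argument for [MPrec] and on the bound for
    [MMin]. *)
Lemma derivable_evalP c xs y :
  derivable (j_eval (mu_code_num c) (ncode xs) y) <-> mu_eval c xs y.
Proof.
elim/mu_code_nested_ind: c xs y => [||i|f gs IHf IHgs|f g IHf IHg|f IHf] xs y.
- split=> [[A B]|->]; first by rewrite step_zero => /eqP.
  by apply: derivable_axiom; rewrite step_zero.
- split=> [[A B]|->]; first by rewrite step_succ nhd_code => /eqP.
  by apply: derivable_axiom; rewrite step_succ nhd_code.
- split=> [[A B]|->]; first by rewrite step_proj nnth_code => /eqP.
  by apply: derivable_axiom; rewrite step_proj nnth_code.
- have IH Y : derivable (j_evals (ncode (map mu_code_num gs)) (ncode xs) Y) <->
      exists2 ys, Y = ncode ys & mu_evals xs gs ys.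
    elim: gs IHgs Y => [|g gs IH] /=.
      move=> _ Y; rewrite derivable_nil; split=> [->|[[|y' ys] //]].
      by exists [::].
    move=> [IHg /IH{}IH] Y; rewrite derivable_evals_cons; split.
      by move=> [z [Z [-> /IHg gz /IH[ys -> ?]]]]; exists (z :: ys).
    move=> [[|z ys] // -> [gz gys]]; exists z, (ncode ys); split=> //.
      exact/IHg.
    by apply/IH; exists ys.
  rewrite derivable_comp mu_eval_comp; split.
    by move=> [Y [/IH[ys -> ?] /IHf ?]]; exists ys.
  move=> [ys ? ?]; exists (ncode ys); split; last exact/IHf.
  by apply/IH; exists ys.
- have E xs' n : derivable (j_eval (mu_code_num (MPrec f g)) (ncons n (ncode
  xs')) y)
      <-> mu_eval (MPrec f g) (n :: xs') y.
    elim: n y => [|n IH] z.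
      by rewrite derivable_prec0 ?nhd_cons // ntl_cons IHf.
    rewrite (@derivable_precS _ _ n) ?nhd_cons // ntl_cons mu_eval_precS; split.
      by move=> [w [/IH ? /(IHg [:: n, w & xs']) ?]]; exists w.
    by move=> [w ? ?]; exists w; split; [apply/IH|apply/(IHg [:: n, w & xs'])].
  (* On an empty list the recursion argument reads as 0, which is the base case. *)
  case: xs => [|n xs]; last exact: E.
  by rewrite derivable_prec0 // -[ntl _]/(ncode [::]) IHf.
- rewrite derivable_min -[ncons y _]/(ncode (y :: xs)) IHf.
  suff -> : derivable (j_below (mu_code_num f) (ncode xs) y) <->
      forall m, m < y -> exists z, mu_eval f (m :: xs) z.+1.
    by rewrite and_comm.
  elim: y => [|y IH]; first by split=> // _; exact: derivable_below0.
  rewrite derivable_belowS IH; split=> [[H [z fz]] m|H].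
    rewrite ltnS leq_eqVlt => /orP[/eqP ->|]; last exact: H.
    by exists z; apply/(IHf (y :: xs)).
  split=> [m my|]; first by apply: H; exact: ltnW.
  by have [//|z fz] := H y; exists z; apply/(IHf (y :: xs)).
Qed.

(** A derivation laid out as a sequence, each entry following from earlier ones. Entry 0 is the
    number 0, so that an absent premise has an index too. *)
Definition certificate (D : nat -> nat) (len : nat) :=
  (D 0 == 0) && allb len (fun j => exb j.+1 (fun p => exb j.+1 (fun q =>
    step (D j.+1) (D p) (D q)))).

Lemma certificate_sound D len j :
  certificate D len -> j < len -> derivable (D j.+1).
Proof.
move=> /andP[/eqP D0 /allbP H].
elim/ltn_ind: j => j IH lt_j.
have /exbP[p lt_p /exbP[q lt_q st]] := H j lt_j.
have D_ok r : r < j.+1 -> D r = 0 \/ derivable (D r).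
  by case: r => [|r] lt_r; [left|right; apply: IH => //; lia].
by apply: Derivable st _ _; exact: D_ok.
Qed.

(** The statement extends an arbitrary certificate, so that the derivations of the two premises can
    be appended one after the other before adding [J]. *)
Lemma certificate_complete J : derivable J -> forall l,
  certificate (nth 0 (0 :: l)) (size l) ->
  exists l', J \in l ++ l' /\
    certificate (nth 0 (0 :: l ++ l')) (size (l ++ l')).
Proof.
have ext A : (A = 0 \/ derivable A) -> (derivable A -> forall l,
    certificate (nth 0 (0 :: l)) (size l) -> exists l', A \in l ++ l' /\
    certificate (nth 0 (0 :: l ++ l')) (size (l ++ l'))) -> forall l,
    certificate (nth 0 (0 :: l)) (size l) -> exists l', A \in 0 :: l ++ l' /\
    certificate (nth 0 (0 :: l ++ l')) (size (l ++ l')).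
  move=> [->|dA] H l cl; first by exists [::]; rewrite cats0.
  by have [l' [? ?]] := H dA l cl; exists l'; rewrite inE; split=> //;
    apply/orP; right.
move: J; fix IH 2 => J [A B st dA dB] l cl.
have [l1 [Al1 cl1]] : exists l', A \in 0 :: l ++ l' /\
    certificate (nth 0 (0 :: l ++ l')) (size (l ++ l')).
  apply: ext cl; [exact: dA|]; clear - IH dA; case: dA => [->|dA] d.
    by case: derivable_neq0.
  exact: (IH _ dA).
have [l2 [Bl2 cl2]] : exists l', B \in 0 :: (l ++ l1) ++ l' /\
    certificate (nth 0 (0 :: (l ++ l1) ++ l')) (size ((l ++ l1) ++ l')).
  apply: ext cl1; [exact: dB|]; clear - IH dB; case: dB => [->|dB] d.
    by case: derivable_neq0.
  exact: (IH _ dB).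
exists (l1 ++ rcons l2 J); rewrite -cats1 !catA.
set l3 := (l ++ l1) ++ l2 in Bl2 cl2 *.
have Al3 : A \in 0 :: l3.
  by move: Al1; rewrite /l3 !inE (mem_cat _ _ l2) => /orP[->|->]; rewrite ?orbT.
split; first by rewrite mem_cat inE eqxx orbT.
have nthl r : r <= size l3 -> nth 0 (0 :: l3 ++ [:: J]) r = nth 0 (0 :: l3) r.
  by move=> le_r; rewrite -cat_cons nth_cat /= ltnS le_r.
apply/andP; split=> //; apply/allbP => j.
rewrite size_cat addn1 ltnS leq_eqVlt => /orP[/eqP ->|lt_j]; last first.
  have /andP[_ /allbP/(_ _ lt_j)/exbP[p lt_p /exbP[q lt_q st']]] := cl2.
  apply/exbP; exists p => //; apply/exbP; exists q => //.
  by rewrite !nthl //; lia.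
have nth_idx C : C \in 0 :: l3 -> nth 0 (0 :: l3 ++ [:: J]) (index C (0 :: l3))
  = C.
  by move=> Cl3; rewrite nthl ?nth_index // -ltnS index_mem.
apply/exbP; exists (index A (0 :: l3)); first by rewrite index_mem.
apply/exbP; exists (index B (0 :: l3)); first by rewrite index_mem.
by rewrite !nth_idx // [nth _ _ _.+1]/= nth_cat ltnn subnn.
Qed.

(** One bound on the code of the certificate, its length and the value makes this decidable and
    monotone in [t]. *)
Definition halts_within e X t :=
  exb t (fun D => exb t (fun len => exb t (fun y =>
    certificate (nnth D) len &&
    exb len (fun j => nnth D j.+1 == j_eval e X y)))).

Lemma halts_within_leq e X s t :
  s <= t -> halts_within e X s -> halts_within e X t.
Proof.
move=> le_st /exbP[D ltD /exbP[len ltl /exbP[y lty H]]].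
apply/exbP; exists D; first exact: leq_trans le_st.
apply/exbP; exists len; first exact: leq_trans le_st.
by apply/exbP; exists y; first exact: leq_trans le_st.
Qed.

(** A form of Kleene's normal form theorem: one recursive predicate, with the code as an argument,
    describes all the domains and so all the tests. *)
Lemma halts_withinP c xs :
  mu_halts c xs <-> exists t, halts_within (mu_code_num c) (ncode xs) t.
Proof.
split=> [[y /derivable_evalP d]|[t /exbP[D _ /exbP[len _ /exbP[y _]]]]].
  have [l [Jl cl]] := certificate_complete d (l := [::]) isT.
  rewrite cat0s in Jl cl; set J := j_eval _ _ _ in d Jl.
  exists (maxn (ncode (0 :: l)) (maxn (size l) y)).+1.
  apply/exbP; exists (ncode (0 :: l)); first by lia.
  apply/exbP; exists (size l); first by lia.
  apply/exbP; exists y; first by lia.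
  have -> : nnth (ncode (0 :: l)) = nth 0 (0 :: l).
    by apply/funext => i; rewrite nnth_code.
  rewrite cl; apply/exbP; exists (index J l); first by rewrite index_mem.
  by rewrite /= nth_index.
move=> /andP[cD /exbP[j lt_j /eqP e]]; exists y.
by apply/derivable_evalP; rewrite -e; exact: certificate_sound cD lt_j.
Qed.

Lemma recursive_halts_within n e X t : recursive n e -> recursive n X ->
  recursive n t -> recursive n (fun xs => halts_within (e xs) (X xs) (t xs)).
Proof.
apply: (@recursive_comp3 halts_within).
rewrite /recursive3 /halts_within /certificate /j_eval.
have H m f g h := @recursive_comp3 _ m f g h recursive_step.
repeat first [apply: recursive_exb; [|by rec] | apply: recursive_allb; [|by rec]
  | apply: recursive_and | apply: (H _ _ _ _); rec | rec].
Qed.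
#[local] Hint Resolve recursive_halts_within : rec.

(** * A universal open set and its leftmost uncovered sequence *)

(** The first argument is fuel; [n] itself is enough, as each digit removed makes the number
    smaller. *)
Fixpoint string_decode_rec k n : seq bool :=
  if k is k'.+1 then
    if n is m.+1 then odd m :: string_decode_rec k' m./2 else [::]
  else [::].

Definition string_decode n := string_decode_rec n n.

Lemma string_decodeK : cancel string_decode string_code.
Proof.
rewrite /string_decode => n; move: {-2 3}n (leqnn n);
  elim: n => [|k IH] [|m] //= lt_mk.
by rewrite IH; [rewrite addnC odd_double_half|lia].
Qed.

Lemma string_code_inj : injective string_code.
Proof.
elim=> [|b x IH] [|c y] //= [e].
have eb : b = c.
  by move: (congr1 odd e); rewrite !oddD !odd_double !oddb.
by rewrite -eb in e *; congr (_ :: _); apply: IH; move: e; lia.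
Qed.

Lemma string_codeK : cancel string_code string_decode.
Proof. by move=> x; apply: string_code_inj; rewrite string_decodeK. Qed.

Lemma string_code_cat x y :
  string_code (x ++ y) = string_code x + 2 ^ size x * string_code y.
Proof. by elim: x => [|b x IH] //=; rewrite ?mul1n // IH expnS; lia. Qed.

(** The strings of length [L] have the consecutive codes from [2 ^ L - 1] to [2 ^ L.+1 - 2]. *)
Lemma string_code_bounds x :
  2 ^ size x <= (string_code x).+1 < 2 ^ (size x).+1.
Proof. by elim: x => [|b x IH] //=; rewrite !expnS in IH *; lia. Qed.

(** This turns every search among the prefixes of a string into a bounded one. *)
Lemma string_code_prefix (x y : seq bool) : prefix x y ->
  string_code x <= string_code y.
Proof. by move=> /prefixP[z ->]; rewrite string_code_cat leq_addr. Qed.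

Lemma recursive_size n f :
  recursive n f -> recursive n (fun xs => size (string_decode (f xs))).
Proof.
apply: (@recursive_comp1 (fun p => size (string_decode p))).
apply: (@eq_recursive 1
  (fun xs => cntb (nth 0 xs 0) (fun i => 2 ^ i.+1 <= (nth 0 xs 0).+1))).
  move=> xs _; set p := nth 0 xs 0; set x := string_decode p.
  rewrite -[p](string_decodeK p) -/x.
  have /andP[lo up] := string_code_bounds x.
  have le_s : size x <= string_code x by move: (ltn_expl (size x) (ltnSn 1));
    lia.
  rewrite /cntb -(subnKC le_s) iotaD count_cat add0n -[RHS]addn0.
  rewrite subnKC //; congr (_ + _).
    rewrite -[RHS](size_iota 0); apply/eqP; rewrite -all_count.
    apply/allP => i; rewrite mem_iota => /andP[_ lt_i].
    by apply: leq_trans lo; rewrite leq_exp2l.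
  apply/eqP; rewrite -leqn0 leqNgt -has_count; apply/hasPn => i.
  rewrite mem_iota => /andP[le_i _]; rewrite -ltnNge.
  by apply: leq_trans up _; rewrite leq_exp2l.
by rec.
Qed.
#[local] Hint Resolve recursive_size : rec.

(** By [string_code_cat], being a prefix is an arithmetic relation whose unknown [r], the code of
    the remainder, is at most the code of the longer string. *)
Lemma recursive_prefix n f g : recursive n f -> recursive n g ->
  recursive n (fun xs => prefix (string_decode (f xs)) (string_decode (g xs))).
Proof.
move=> rf rg; apply: (@eq_recursive n (fun xs => exb (g xs).+1
  (fun r => g xs == f xs + 2 ^ size (string_decode (f xs)) * r))).
  move=> xs _; congr nat_of_bool; apply/exbP/prefixP.
    move=> [r _ /eqP e]; exists (string_decode r); apply: string_code_inj.
    by rewrite string_code_cat !string_decodeK.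
  move=> [z e]; exists (string_code z).
    have := congr1 string_code e; rewrite string_code_cat string_decodeK => ->.
    have : 0 < 2 ^ size (string_decode (f xs)) by rewrite expn_gt0.
    by nia.
  by rewrite -[g xs]string_decodeK e string_code_cat string_decodeK.
have rP : recursive n.+1 (fun xs => g (behead xs)).
  exact: recursive_behead.
have rf' : recursive n.+1 (fun xs => f (behead xs)) by exact: recursive_behead.
by rec.
Qed.
#[local] Hint Resolve recursive_prefix : rec.

Lemma string_code_rcons x b :
  string_code (rcons x b) = string_code x + 2 ^ size x * b.+1.
Proof. by rewrite -cats1 string_code_cat /= add0n. Qed.

Lemma recursive_rcons n f b : recursive n f ->
  recursive n (fun xs => string_code (rcons (string_decode (f xs)) b)).
Proof.
move=> rf; apply: (@eq_recursive n
  (fun xs => f xs + 2 ^ size (string_decode (f xs)) * b.+1)); last by rec.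
by move=> xs _; rewrite string_code_rcons string_decodeK.
Qed.
#[local] Hint Resolve recursive_rcons : rec.

(* Stage [size z] of the enumeration of the [e]-th test at level [e + 2]. *)
Definition enumerated e (z : seq bool) :=
  exb (string_code z).+1 (fun p =>
    prefix (string_decode p) z && halts_within e (ncode [:: e.+2; p]) (size z)).

Lemma enumeratedP e z : reflect
  (exists2 x, prefix x z &
     halts_within e (ncode [:: e.+2; string_code x]) (size z))
  (enumerated e z).
Proof.
apply: (iffP (exbP _ _)) => [[p _ /andP[pz h]]|[x xz h]].
  by exists (string_decode p); rewrite ?string_decodeK.
exists (string_code x); first by rewrite ltnS string_code_prefix.
by rewrite string_codeK xz.
Qed.

Lemma enumerated_prefix e (y z : seq bool) : prefix y z -> enumerated e y ->
  enumerated e z.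
Proof.
move=> yz /enumeratedP[x xy h]; apply/enumeratedP; exists x.
  exact: prefix_trans yz.
by apply: halts_within_leq h; exact: size_prefix.
Qed.

(** As [v] runs below [2 ^ L], the decoded strings are exactly those of length [L]. *)
Definition count_level L (P : pred (seq bool)) :=
  cntb (2 ^ L) (fun v => P (string_decode (v + (2 ^ L).-1))).

(* Stages at which the [e]-th test still has measure at most [2 ^- (e + 2)];
   trimming it to these stages bounds the measure without losing genuine tests.
     *)
Definition good_stage e s := 2 ^ e.+2 * count_level s (enumerated e) <= 2 ^ s.

(** Looking only at tests numbered up to the length of [z] keeps this decidable; each test is still
    reached at long enough prefixes. This is the set [B] of the introduction. *)
Definition universal z :=
  exb (size z).+1 (fun e => good_stage e (size z) && enumerated e z).

Definition covered_within (B : pred (seq bool)) (x : seq bool) s :=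
  allb (2 ^ (size x + s).+1) (fun q =>
    (size (string_decode q) == size x + s) && prefix x (string_decode q) ==>
    exb q.+1 (fun p => prefix (string_decode p) (string_decode q) &&
      B (string_decode p))).

Lemma covered_withinP (B : pred (seq bool)) (x : seq bool) s : reflect
  (forall z : seq bool, size z = size x + s -> prefix x z ->
    exists2 y, prefix y z & B y)
  (covered_within B x s).
Proof.
apply: (iffP (allbP _ _)) => [H z sz xz|H q _].
  have /H : string_code z < 2 ^ (size x + s).+1.
    by rewrite -sz; have /andP[_ /ltnW] := string_code_bounds z.
  rewrite string_codeK sz eqxx xz => /exbP[p _ /andP[pz Bp]].
  by exists (string_decode p).
apply/implyP => /andP[/eqP sz xz]; have [y yz By] := H _ sz xz.
apply/exbP; exists (string_code y); last by rewrite string_codeK yz.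
by rewrite ltnS -[q]string_decodeK string_code_prefix.
Qed.

Lemma covered_within_leq (B : pred (seq bool)) (x : seq bool) s t :
  s <= t -> covered_within B x s -> covered_within B x t.
Proof.
move=> le_st /covered_withinP c; apply/covered_withinP => z sz xz.
have [| |y yt By] := c (take (size x + s) z).
- by rewrite size_takel // sz leq_add2l.
- by move: xz => /prefixP[w ->]; rewrite takeD take_size_cat // prefix_prefix.
- by exists y => //; apply: prefix_trans yt _; exact: prefix_take.
Qed.

(** By compactness this amounts to the inclusion of the cylinder of [x] in the open set generated by
    [B], in a form that a search over [s] can confirm. *)
Definition covered (B : pred (seq bool)) (x : seq bool) :=
  exists s, covered_within B x s.

Lemma covered_split B (x : seq bool) :
  covered B (rcons x false) -> covered B (rcons x true) -> covered B x.
Proof.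
move=> [s0 /covered_withinP c0] [s1 /covered_withinP c1].
(* The successor accounts for the bit by which the two halves are longer than [x]. *)
exists (maxn s0 s1).+1; apply/covered_withinP => z sz /prefixP[[|b w] ez].
  by exfalso; move: sz; rewrite ez size_cat /=; lia.
suff H s : (forall z : seq bool, size z = size (rcons x b) + s ->
  prefix (rcons x b) z ->
    exists2 y, prefix y z & B y) -> s <= maxn s0 s1 ->
    exists2 y, prefix y z & B y.
  by case: b ez H => ez H; [apply: (H s1)|apply: (H s0)] => //; lia.
move=> c le_s; have [| |y yt By] := c (take (size (rcons x b) + s) z).
- by rewrite size_takel // sz size_rcons; lia.
- rewrite ez -cat_rcons takeD take_size_cat //.
  by rewrite drop_size_cat // prefix_prefix.
- by exists y => //; apply: prefix_trans yt _; exact: prefix_take.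
Qed.

Lemma covered_of_prefix (B : pred (seq bool)) (x y : seq bool) : prefix y x ->
  B y -> covered B x.
Proof.
move=> yx By; exists 0; apply/covered_withinP => z _ xz.
by exists y => //; exact: prefix_trans xz.
Qed.

(** The path turns right only where the left half is covered; by [covered_split] it then never
    enters a covered string. *)
Lemma leftmost_uncovered B : ~ covered B [::] ->
  exists a : nat -> bool, forall n, ~ covered B (mkseq a n) /\
    (a n -> covered B (rcons (mkseq a n) false)).
Proof.
move=> nc; pose step x := rcons x `[< covered B (rcons x false) >].
pose path n := iter n step [::].
pose a n := `[< covered B (rcons (path n) false) >].
have pathE n : mkseq a n = path n.
  by elim: n => // n IH; rewrite mkseqS IH.
exists a => n; rewrite pathE; split; last by move/asboolP.
elim: n => // n IH cS; apply: IH; move: cS; rewrite /= {1}/step.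
by case: asboolP => // c0 c1; exact: covered_split.
Qed.

Lemma recursive_enumerated n f g : recursive n f -> recursive n g ->
  recursive n (fun xs => enumerated (f xs) (string_decode (g xs))).
Proof.
apply: (@recursive_comp2 (fun e p => enumerated e (string_decode p) : nat)).
rewrite /recursive2 /enumerated /ncode /=.
apply: recursive_exb; last by under eq_fun do rewrite string_decodeK; rec.
by rec.
Qed.
#[local] Hint Resolve recursive_enumerated : rec.

Lemma recursive_universal n f : recursive n f ->
  recursive n (fun xs => universal (string_decode (f xs))).
Proof.
apply: (@recursive_comp1 (fun p => universal (string_decode p) : nat)).
rewrite /recursive1 /universal /good_stage /count_level /=; rec.
Qed.
#[local] Hint Resolve recursive_universal : rec.

Lemma recursive_covered_within n f g : recursive n f -> recursive n g ->
  recursive n (fun xs => covered_within universal (string_decode (f xs)) (g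
    xs)).
Proof.
apply: (@recursive_comp2
  (fun p s => covered_within universal (string_decode p) s : nat)).
by rewrite /recursive2 /covered_within /=; rec.
Qed.
#[local] Hint Resolve recursive_covered_within : rec.

(** * The uniform measure on Cantor space *)

Import Order.TTheory GRing.Theory Num.Theory.
Import numFieldNormedType.Exports.
Local Open Scope classical_set_scope.
Local Open Scope ring_scope.

Lemma cylinder_rcons x b :
  cylinder (rcons x b) = cylinder x `&` [set u : cantor | u (size x) = b].
Proof.
apply/seteqP; split=> u; rewrite /cylinder /= size_rcons mkseqS.
  by move/rcons_inj => [-> ->].
by move=> [-> ->].
Qed.

Lemma take_mkseq (T : Type) (f : nat -> T) m n :
  (m <= n)%N -> take m (mkseq f n) = mkseq f m.
Proof. by move=> le_mn; rewrite -map_take take_iota (minn_idPl le_mn). Qed.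

Lemma cylinder_prefix (x y : seq bool) :
  prefix x y -> cylinder y `<=` cylinder x.
Proof.
move=> xy u; rewrite /cylinder /= => uy.
have /eqP xE : take (size x) y == x by rewrite -prefixE.
by rewrite -[RHS]xE -uy take_mkseq // size_prefix.
Qed.

Lemma cylinder_mkseq (u : cantor) n : cylinder (mkseq u n) u.
Proof. by rewrite /cylinder /= size_mkseq. Qed.

Lemma cylinder_mkseq_nth (u v : cantor) n :
  cylinder (mkseq u n) v -> forall i, (i < n)%N -> v i = u i.
Proof.
rewrite /cylinder /mkset size_mkseq => uv i lt_in.
by have /(congr1 (nth false ^~ i)) := uv; rewrite !nth_mkseq.
Qed.

Lemma cylinder_mkseqP (u : cantor) x n : (size x <= n)%N ->
  cylinder x u <-> prefix x (mkseq u n).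
Proof.
move=> le_xn; split; last by move/cylinder_prefix; apply; exact: cylinder_mkseq.
by rewrite prefixE take_mkseq // => <-; rewrite size_mkseq.
Qed.

Lemma measurable_coord i b : measurable [set u : cantor | u i = b].
Proof.
apply: sub_sigma_algebra.
have : open ((fun u : cantor_space => u i) @^-1` [set b]).
  apply: open_comp => [u _|]; last exact: discrete_open.
  exact: (@proj_continuous _ (fun=> bool : topologicalType)).
exact.
Qed.

Lemma measurable_cylinder x : measurable (cylinder x).
Proof.
elim/last_ind: x => [|x b IH].
  suff -> : cylinder [::] = setT by exact: measurableT.
  by apply/seteqP; split.
by rewrite cylinder_rcons; apply: measurableI => //; exact: measurable_coord.
Qed.

(** The prefixes of [u] generate a filter converging to [u]: in the product topology it is enough to
    check each coordinate, and coordinate [i] is fixed by a prefix of length [i.+1]. *)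
Lemma open_bigcup_cylinder (O : set cantor_space) : open O ->
  O = \bigcup_(x in [set x | cylinder x `<=` O]) cylinder x.
Proof.
move=> oO; apply/seteqP; split=> [u Ou|u [x xO xu]]; last exact: xO.
suff [n _ nO] : filter_from setT (fun n => cylinder (mkseq u n)) O.
  by exists (mkseq u n) => //; exact: cylinder_mkseq.
have : nbhs u O by apply: open_nbhs_nbhs.
have FF : Filter (filter_from setT (fun n => cylinder (mkseq u n))).
  apply: filter_from_filter; first by exists 0%N.
  move=> i j _ _; exists (maxn i j) => // v.
  by move=> vij; split; apply: cylinder_prefix vij;
    rewrite prefixE size_mkseq take_mkseq // ?leq_maxl ?leq_maxr.
suff : filter_from setT (fun n => cylinder (mkseq u n)) --> (u : cantor_space).
  exact.
apply/cvg_sup => i; apply/cvg_image.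
  by apply/seteqP; split=> // b _; exists (fun=> b).
move=> A /nbhs_singleton Aui; exists [set v | A (v i)].
  exists i.+1 => // v /cylinder_mkseq_nth vu.
  by rewrite /mkset vu.
by apply/seteqP; split=> [_ [v Av <-] //|b Ab]; exists (fun=> b).
Qed.

Lemma measurable_bigcup_countType d (T : measurableType d) (I : countType)
    (D : set I) (F : I -> set T) :
  (forall i, D i -> measurable (F i)) -> measurable (\bigcup_(i in D) F i).
Proof.
move=> mF; rewrite bigcup_mkcond; apply: countable_bigcupT_measurable => // i.
by case: ifPn => // /set_mem; exact: mF.
Qed.

Lemma measurable_fun_cantor d (T : measurableType d) (f : T -> cantor) :
  (forall x, measurable (f @^-1` cylinder x)) -> measurable_fun setT f.
Proof.
move=> mf.
apply: (@measurability _ _ T cantor setT f (@open cantor_space)) => //.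
move=> _ [U oU <-]; rewrite setTI [X in _ @^-1` X]open_bigcup_cylinder //
  preimage_bigcup.
by apply: measurable_bigcup_countType => x _; exact: mf.
Qed.

Lemma mnormalizeE d (T : measurableType d) (R : realType)
    (mu : {measure set T -> \bar R}) (P : probability T R) (A : set T) (c : R) :
  c != 0 -> mu setT = c%:E -> mnormalize mu P A = (mu A * c^-1%:E)%E.
Proof. by move=> c0 muc; rewrite /mnormalize muc eqe (negbTE c0). Qed.

Section UniformMeasure.
Variable R : realType.

(** The binary expansion of [u]; [lam] will be the image of Lebesgue measure under it. *)
Definition digits (u : R) : cantor :=
  fun i => odd (Num.truncn (2 ^+ i.+1 * u)).

Lemma truncn_half (u : R) : 0 <= u -> Num.truncn u = (Num.truncn (2 * u))./2.
Proof.
move=> u0; apply/eqP; rewrite truncn_eq //.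
have /andP[lo up] : (Num.truncn (2 * u))%:R <= 2 * u < (Num.truncn (2 *
  u)).+1%:R.
  by rewrite truncn_itv // mulr_ge0.
set k := Num.truncn _ in lo up *.
have /andP[lo2 up2] : (k./2.*2 <= k < k./2.+1.*2)%N.
  by rewrite -[X in (_ <= X < _)%N]odd_double_half doubleS;
    case: (odd k) => /=; lia.
apply/andP; split.
  rewrite -(ler_pM2l (x := 2)) //; apply: le_trans lo.
  by rewrite -natrM ler_nat mul2n.
rewrite -(ltr_pM2l (x := 2)) //; apply: lt_le_trans up _.
by rewrite -natrM ler_nat mul2n.
Qed.

(** The first digits of [u] are those of the integer part of [2 ^+ size x * u], so a cylinder
    corresponds to one integer, hence to one dyadic interval. *)
Lemma digits_cylinder x : exists2 k, (k < 2 ^ size x)%N &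
  forall u, 0 <= u < 1 ->
    cylinder x (digits u) <-> Num.truncn (2 ^+ size x * u) = k.
Proof.
elim/last_ind: x => [|x b [k lt_k IH]].
  exists 0%N => // u /andP[u0 u1]; split=> // _.
  by apply/eqP; rewrite expr0 mul1r truncn_eq // u0.
exists (b + k.*2)%N; first by rewrite size_rcons expnS; case: b; lia.
move=> u u01; rewrite cylinder_rcons size_rcons.
have u0 : 0 <= 2 ^+ size x * u by rewrite mulr_ge0 ?exprn_ge0 //;
  case/andP: u01.
have -> : (cylinder x `&` [set v | v (size x) = b]) (digits u) <->
    Num.truncn (2 ^+ size x * u) = k /\ digits u (size x) = b.
  by rewrite -IH.
rewrite /digits truncn_half // mulrA -exprS.
set t := Num.truncn _; split=> [[<- <-]|->]; first exact/esym/odd_double_half.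
by rewrite half_bit_double oddD odd_double addbF oddb.
Qed.

Let I01 : set R := `[0, 1[%classic.

Lemma digits_preimage x : exists k : nat,
  digits @^-1` cylinder x `&` I01 =
  `[k%:R / 2 ^+ size x, k.+1%:R / 2 ^+ size x[%classic.
Proof.
have [k lt_k H] := digits_cylinder x; exists k.
have p : (0 : R) < 2 ^+ size x by rewrite exprn_gt0.
have E (u : R) : 0 <= u -> (k%:R / 2 ^+ size x <= u < k.+1%:R / 2 ^+ size x) =
    (Num.truncn (2 ^+ size x * u) == k).
  move=> u0; rewrite truncn_eq; last by rewrite mulr_ge0 // ltW.
  by rewrite ler_pdivrMr // ltr_pdivlMr // mulrC.
apply/seteqP; split=> u; rewrite /I01 /= !in_itv /=.
  by move=> [Hu u01]; rewrite E; [apply/eqP/H|case/andP: u01].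
move=> Hu; have u01 : 0 <= u < 1.
  case/andP: (Hu) => lo up; apply/andP; split.
    by apply: le_trans lo; rewrite divr_ge0 // ltW.
  apply: lt_le_trans up _; rewrite ler_pdivrMr // mul1r.
  by rewrite -natrX ler_nat.
split=> //; apply/H => //; apply/eqP; rewrite -E //.
by case/andP: u01.
Qed.

(** A constant value outside the unit interval makes measurability on the whole line immediate, and
    Lebesgue measure is restricted to the interval anyway. *)
Let clip_digits (u : measurableTypeR R) : cantor :=
  if 0 <= (u : R) < 1 then digits u else digits 0.

Lemma measurable_digits :
  measurable_fun setT clip_digits.
Proof.
have mI01 : measurable (I01 : set (measurableTypeR R)) by exact: measurable_itv.
apply: measurable_fun_cantor => x.
suff -> : clip_digits @^-1` cylinder x = digits @^-1` cylinder x `&` I01 `|`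
    [set u | ~ I01 u /\ cylinder x (digits 0)].
  apply: measurableU.
    by have [k ->] := digits_preimage x; exact: measurable_itv.
  have [c0|c0] := pselect (cylinder x (digits 0)).
    rewrite (_ : [set _ | _] = ~` I01); first exact: measurableC.
    by apply/seteqP; split=> u; [move=> [uI _]; exact: uI|move=> uI; split].
  rewrite (_ : [set _ | _] = set0); first exact: measurable0.
  by apply/seteqP; split=> u; [move=> [_ /c0]|].
apply/seteqP; split=> u; rewrite /I01 /preimage /clip_digits /= in_itv /=.
  by case: ifP => u01 c; [left|right].
by move=> [[c ->]|[/negP/negbTE -> c]].
Qed.

Lemma ex_uniform_measure : exists lam : probability cantor R,
  forall x, lam (cylinder x) = (2 ^- size x)%:E.
Proof.
have mI01 : measurable (I01 : set (measurableTypeR R)) by exact: measurable_itv.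
pose mu := mrestr (@lebesgue_measure R) mI01.
(* The total mass is already 1; normalizing only provides the structure of a probability. *)
pose P : probability (measurableTypeR R) R := mnormalize mu point.
exists (distribution P (mfun_Sub (mem_set measurable_digits))) => x.
have mu1 : mu setT = 1%E.
  rewrite /mu /mrestr setTI.
  have := @lebesgue_measure_itv R (`[0, 1[); rewrite /= lte01 => ->.
  by rewrite oppr0 adde0.
have PE A : P A = mu A.
  by rewrite [LHS](mnormalizeE _ _ (oner_neq0 R) mu1) invr1 mule1.
rewrite [LHS]PE /mu /mrestr.
have -> : clip_digits @^-1` cylinder x `&` I01 = digits @^-1` cylinder x `&`
  I01.
  apply/seteqP; split=> u; rewrite /I01 /preimage /clip_digits /= in_itv /=.
    by move=> [+ u01]; rewrite u01.
  by move=> [cu u01]; rewrite u01.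
have [k ->] := digits_preimage x.
have p : (0 : R) < 2 ^+ size x by rewrite exprn_gt0.
have := @lebesgue_measure_itv R `[k%:R / 2 ^+ size x, k.+1%:R / 2 ^+ size x[.
rewrite /= lte_fin ltr_pM2r ?invr_gt0 // ltr_nat ltnSn => ->.
by rewrite -EFinB -mulrBl -natrB // subSnn mul1r.
Qed.

End UniformMeasure.

(** * The measure of the universal open set *)

Section UniversalTest.
Variables (R : realType) (lam : probability cantor R).
Hypothesis lam_cylinder : forall x, lam (cylinder x) = (2 ^- size x)%:E.

Lemma measurable_level L (P : pred (seq bool)) :
  measurable [set u : cantor | P (mkseq u L)].
Proof.
rewrite (_ : [set _ | _] =
  \bigcup_(x in [set x | size x = L /\ P x]) cylinder x).
  by apply: measurable_bigcup_countType => x _; exact: measurable_cylinder.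
apply/seteqP; split=> [u Pu|u [x [<- Px]]].
  exists (mkseq u L); first by rewrite /mkset size_mkseq.
  exact: cylinder_mkseq.
by rewrite /cylinder /= => ->.
Qed.

Lemma size_string_decode_level L v :
  (v < 2 ^ L)%N -> size (string_decode (v + (2 ^ L).-1)) = L.
Proof.
move=> lt_v; set x := string_decode _.
have := string_code_bounds x; rewrite string_decodeK => /andP[lo up].
have L0 : (0 < 2 ^ L)%N by rewrite expn_gt0.
have e : (v + (2 ^ L).-1).+1 = (v + 2 ^ L)%N by lia.
rewrite e in lo up; apply/eqP; rewrite eqn_leq; apply/andP; split.
  rewrite -ltnS -(@ltn_exp2l 2) //; apply: leq_ltn_trans lo _.
  by rewrite expnS; lia.
rewrite -ltnS -(@ltn_exp2l 2) //; apply: leq_ltn_trans up.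
exact: leq_addl.
Qed.

Lemma lam_level L (P : pred (seq bool)) :
  lam [set u | P (mkseq u L)] = ((count_level L P)%:R / 2 ^+ L)%:E.
Proof.
(* The first [k] strings of length [L], in the order of their codes: each step of the induction adds
   at most one cylinder, disjoint from the previous ones. *)
pose S k := [set u : cantor | (string_code (mkseq u L) < k + (2 ^ L).-1)%N &&
  P (mkseq u L)].
have mS k : measurable (S k).
  exact: (measurable_level L (fun x => (string_code x < k + (2 ^ L).-1)%N && P
    x)).
suff H k : (k <= 2 ^ L)%N -> lam (S k) =
    ((cntb k (fun v => P (string_decode (v + (2 ^ L).-1))))%:R / 2 ^+ L)%:E.
  rewrite -(H _ (leqnn _)); congr (lam _); apply/seteqP; split=> u;
    last by case/andP.
  move=> /= Pu; rewrite /S /= Pu andbT.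
  have /andP[_] := string_code_bounds (mkseq u L).
  by rewrite size_mkseq expnS; lia.
elim: k => [_|k IH lt_k].
  rewrite mul0r (_ : S 0%N = set0) ?measure0 //.
  apply/seteqP; split=> u //; rewrite /S /= add0n => /andP[+ _].
  have /andP[+ _] := string_code_bounds (mkseq u L).
  by rewrite size_mkseq; lia.
set x := string_decode (k + (2 ^ L).-1).
have sx : size x = L by exact: size_string_decode_level.
have SE : S k.+1 = S k `|` (if P x then cylinder x else set0).
  apply/seteqP; split=> u; rewrite /S /=.
    rewrite addSn ltnS leq_eqVlt => /andP[/orP[/eqP e|lt] Pu]; last first.
      by left; rewrite lt.
    have e' : mkseq u L = x by apply: string_code_inj; rewrite string_decodeK.
    by right; rewrite -e' Pu /cylinder /= size_mkseq.
  case=> [/andP[lt Pu]|]; first by rewrite Pu addSn ltnS (ltnW lt).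
  case: ifP => // Px; rewrite /cylinder /= sx => ->.
  by rewrite Px string_decodeK addSn ltnSn.
rewrite SE measureU //; last 2 first.
- by case: ifP => _; [exact: measurable_cylinder|exact: measurable0].
- apply/seteqP; split=> u // [] /andP[lt _]; case: ifP => // _.
  rewrite /cylinder /= sx => e; move: lt.
  by rewrite e string_decodeK ltnn.
rewrite [X in (X + _)%E](IH (ltnW lt_k)) cntbS -/x natrD mulrDl EFinD;
  congr (_ + _)%E.
case: ifP => _; last by rewrite mul0r measure0.
by rewrite mul1r -sx; exact: lam_cylinder.
Qed.

Definition trimmed e s :=
  [set u : cantor | exists2 t, (t <= s)%N &
     good_stage e t && enumerated e (mkseq u t)].

(** Enumeration is monotone along prefixes, so a good stage absorbs all earlier ones and a bad stage
    adds nothing. Hence the measure is always controlled by the last good stage. *)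
Lemma trimmedS e s : trimmed e s.+1 = trimmed e s \/
  good_stage e s.+1 /\ trimmed e s.+1 = [set u | enumerated e (mkseq u s.+1)].
Proof.
have [g|ng] := boolP (good_stage e s.+1).
  right; split=> //; apply/seteqP; split=> u; last by exists s.+1; rewrite // g.
  move=> [t le_t /andP[_]]; apply: enumerated_prefix.
  by rewrite prefixE size_mkseq take_mkseq.
left; apply/seteqP; split=> u [t le_t ut]; exists t => //; last exact: leqW.
move: le_t; rewrite leq_eqVlt => /orP[/eqP et|//].
by move: ut; rewrite et (negbTE ng).
Qed.

Lemma lam_good_stage e s : good_stage e s ->
  (lam [set u | enumerated e (mkseq u s)] <= (2 ^- e.+2)%:E)%E.
Proof.
rewrite lam_level lee_fin /good_stage => g.
rewrite ler_pdivrMr ?exprn_gt0 // -ler_pdivrMl ?invr_gt0 ?exprn_gt0 // invrK.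
by rewrite -!natrX -natrM ler_nat.
Qed.

Lemma measurable_trimmed e s : measurable (trimmed e s).
Proof.
rewrite (_ : trimmed e s = \bigcup_(t in [set t | (t <= s)%N /\ good_stage e t])
   [set u | enumerated e (mkseq u t)]).
  by apply: bigcup_measurable => t _; exact: measurable_level.
apply/seteqP; split=> u; first by move=> [t le_t /andP[g ut]]; exists t.
by move=> [t [le_t g] ut]; exists t => //; apply/andP.
Qed.

Lemma lam_trimmed e s : (lam (trimmed e s) <= (2 ^- e.+2)%:E)%E.
Proof.
elim: s => [|s IH]; last first.
  by have [->//|[g ->]] := trimmedS e s; exact: lam_good_stage.
have [g|ng] := boolP (good_stage e 0).
  rewrite (_ : trimmed e 0 = [set u | enumerated e (mkseq u 0)]).
    exact: lam_good_stage.
  apply/seteqP; split=> u; last by exists 0%N; rewrite // g.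
  by move=> [t]; rewrite leqn0 => /eqP -> /andP[].
rewrite (_ : trimmed e 0 = set0) ?measure0 ?lee_fin ?invr_ge0 ?exprn_ge0 //.
apply/seteqP; split=> u // [t]; rewrite leqn0 => /eqP ->.
by rewrite (negbTE ng).
Qed.

Definition universal_set := [set u : cantor | exists n, universal (mkseq u n)].

Lemma measurable_universal_set : measurable universal_set.
Proof.
rewrite (_ : universal_set = \bigcup_n [set u | universal (mkseq u n)]).
  by apply: bigcupT_measurable => n; exact: measurable_level.
by apply/seteqP; split=> u [n]; [exists n|exists n].
Qed.

Lemma lam_universal_set : (lam universal_set <= (2^-1)%:E)%E.
Proof.
have mT e : measurable (\bigcup_s trimmed e s).
  by apply: bigcupT_measurable => s; exact: measurable_trimmed.
have bT e : (lam (\bigcup_s trimmed e s) <= (2 ^- e.+2)%:E)%E.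
  have nd : nondecreasing_seq (trimmed e).
    move=> s s' le_s; apply/subsetPset => u [t le_t ut].
    by exists t => //; exact: leq_trans le_s.
  have cv := nondecreasing_cvg_mu (mu := lam) (measurable_trimmed e) (mT e) nd.
  rewrite -(cvg_lim _ cv) //; apply: lime_le; first by apply/cvgP; exact: cv.
  by apply: nearW => s; exact: lam_trimmed.
have sub : universal_set `<=` \bigcup_e \bigcup_s trimmed e s.
  move=> u [n /exbP[e _ ue]]; exists e => //; exists n => //.
  by exists n => //; move: ue; rewrite size_mkseq.
apply: (le_trans (measure_sigma_subadditive _ mT measurable_universal_set sub)).
have h0 : 0 <= 2^-1 :> R by rewrite invr_ge0.
(* The bounds [2 ^- e.+2] of the trimmed tests sum to one half. *)
apply: le_trans (epsilon_trick0 xpredT h0).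
apply: lee_nneseries => e _ //; apply: le_trans (bT e) _.
by rewrite lee_fin natrX -invfM -exprS.
Qed.

Lemma universal_setP (V : nat -> set cantor) (u : cantor) :
  ml_test lam V -> (\bigcap_n V n) u -> universal_set u.
Proof.
move=> [[c VE] lamV] Vu; set e := mu_code_num c.
have [x /halts_withinP[t ht] xu] : exists2 x,
    mu_halts c [:: e.+2; string_code x] & cylinder x u.
  by have := Vu e.+2 I; rewrite VE => -[x]; exists x.
have mV n : measurable (V n).
  by rewrite VE; apply: measurable_bigcup_countType => y _;
    exact: measurable_cylinder.
(* Long enough to contain [x], to see the computation halt, and to have test number [e] considered
   by [universal]. *)
pose s := maxn e (maxn (size x) t).
have enum : enumerated e (mkseq u s).
  apply/enumeratedP; exists x; first by apply/cylinder_mkseqP => //; lia.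
  by rewrite size_mkseq; apply: halts_within_leq ht; lia.
exists s; apply/exbP; exists e; rewrite size_mkseq; first by lia.
rewrite enum andbT /good_stage.
(* What is enumerated at stage [s] lies in [V e.+2], so a genuine test is never trimmed. *)
have : (lam [set v | enumerated e (mkseq v s)] <= (2 ^- e.+2)%:E)%E.
  apply: le_trans (lamV e.+2); apply: le_measure; rewrite ?inE //.
    exact: measurable_level.
  move=> v /enumeratedP[y yv hy]; rewrite VE; exists y.
    by apply/halts_withinP; exists (size (mkseq v s)).
  by apply: cylinder_prefix yv _ _; exact: cylinder_mkseq.
rewrite lam_level lee_fin ler_pdivrMr ?exprn_gt0 //.
rewrite -ler_pdivrMl ?invr_gt0 ?exprn_gt0 // invrK.
by rewrite -!natrX -natrM ler_nat.
Qed.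

End UniversalTest.

(** * The counterexample *)

(** [MMin] looks for a zero, hence the negation of [D]. *)
Lemma halting_search (D : nat -> nat -> nat -> bool) :
  recursive3 (fun t n z => D t n z : nat) ->
  exists c, forall n z, mu_halts c [:: n; z] <-> exists t, D t n z.
Proof.
move=> rD; have [c cP] : recursive 3 (fun xs => ~~ D (nth 0%N xs 0)
    (nth 0%N xs 1) (nth 0%N xs 2) : nat) by exact: recursive_neg.
have cE t n z y : mu_eval c [:: t; n; z] y <-> y = ~~ D t n z by exact: cP.
exists (MMin c) => n z; split=> [[t [/cE Dt _]]|ex].
  by exists t; move: Dt; case: (D t n z).
case: (ex_minnP ex) => t Dt min_t; exists t; split; first by apply/cE;
  rewrite Dt.
move=> m lt_m; exists 0%N; apply/cE.
by case: (boolP (D m n z)) => // /min_t; lia.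
Qed.

(** The string [y] is a correct record along [w]. The inner search reads the bit of [y] at position
    [size p]: it is true when a prefix of that length is followed by [true] in [y]. *)
Definition agrees_with_universal (y w : seq bool) :=
  allb (string_code w).+1 (fun p =>
    prefix (string_decode p) w && (size (string_decode p) < size y)%N ==>
    (universal (string_decode p) == exb (string_code y).+1 (fun v =>
      (size (string_decode v) == size (string_decode p)) &&
      prefix (rcons (string_decode v) true) y))).

Lemma agrees_with_universalP (y w : seq bool) : (size y <= size w)%N ->
  reflect (forall i, (i < size y)%N -> universal (take i w) = nth false y i)
    (agrees_with_universal y w).
Proof.
move=> le_yw.
have bitE i : (i < size y)%N -> exb (string_code y).+1 (fun v =>
    (size (string_decode v) == i) && prefix (rcons (string_decode v) true) y) =
    nth false y i.
  move=> lt_i; apply/exbP/idP => [[v _ /andP[/eqP <- /prefixP[z ->]]]|yi].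
    by rewrite nth_cat size_rcons ltnSn nth_rcons ltnn eqxx.
  exists (string_code (take i y)).
    by rewrite ltnS string_code_prefix // prefix_take.
  by rewrite string_codeK size_takel ?(ltnW lt_i) // eqxx /= -yi -take_nth //
    prefix_take.
apply: (iffP (allbP _ _)) => [H i lt_i|H p _].
  have := H (string_code (take i w)).
  rewrite ltnS string_code_prefix ?prefix_take // string_codeK prefix_take.
  have si : size (take i w) = i by rewrite size_takel //; lia.
  by rewrite si lt_i bitE // => /(_ isT)/eqP.
apply/implyP => /andP[pw lt_p]; rewrite bitE // -H //.
by move: pw; rewrite prefixE => /eqP ->.
Qed.

Lemma recursive_agrees n f g : recursive n f -> recursive n g ->
  recursive n (fun xs => agrees_with_universal (string_decode (f xs))
    (string_decode (g xs))).
Proof.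
apply: (@recursive_comp2
  (fun y w => agrees_with_universal (string_decode y) (string_decode w) : nat)).
rewrite /recursive2 /agrees_with_universal.
under eq_fun do rewrite !string_decodeK.
apply: recursive_allb; last by rec.
apply: recursive_imply; first by rec.
apply: recursive_eqb; first by rec.
apply: recursive_exb; last by rec.
apply: recursive_and; first by rec.
apply: eq_recursive (recursive_prefix (recursive_rcons true _) _) => [xs _||].
  by rewrite string_codeK.
by rec.
by rec.
Qed.
#[local] Hint Resolve recursive_agrees : rec.

Section Counterexample.
Variables (R : realType) (lam : probability cantor R).
Hypothesis lam_cylinder : forall x, lam (cylinder x) = (2 ^- size x)%:E.

Definition universal_times (u : cantor) : cantor :=
  fun n => universal (mkseq u n).

Definition with_times (u : cantor) : cantor * cantor := (u, universal_times u).

(** Bit [i] of the record depends only on the prefix of length [i], so the first [n] bits of [u]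
    settle the first [n] bits of the record. *)
Lemma universal_times_cylinder (u : cantor) y n : (size y <= n)%N ->
  cylinder y (universal_times u) <-> agrees_with_universal y (mkseq u n).
Proof.
move=> le_yn; split=> [uy|/agrees_with_universalP].
  apply/agrees_with_universalP; rewrite ?size_mkseq // => i lt_i.
  by rewrite take_mkseq ?(leq_trans (ltnW lt_i)) // -uy nth_mkseq.
rewrite size_mkseq => /(_ le_yn) H; rewrite /cylinder /mkset.
apply: (@eq_from_nth _ false); rewrite size_mkseq // => i lt_i.
rewrite nth_mkseq // -H // take_mkseq //; exact: leq_trans (ltnW lt_i) _.
Qed.

Lemma measurable_with_times : measurable_fun setT with_times.
Proof.
apply: measurable_fun_pair; first exact: measurable_id.
apply: measurable_fun_cantor => y.
rewrite (_ : _ @^-1` _ = [set u | agrees_with_universal y (mkseq u (size y))]).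
  exact: measurable_level.
by apply/seteqP; split=> u /universal_times_cylinder; apply.
Qed.

Definition times_law : probability (cantor * cantor)%type R :=
  distribution lam (mfun_Sub (mem_set measurable_with_times)).

Lemma times_lawE A : times_law A = lam (with_times @^-1` A).
Proof. by []. Qed.

(** The first [size x + size y] bits of [u] decide the event, so its measure is an exact dyadic
    rational, whatever the precision [k]. *)
Lemma computable_times_law : computable_measure2 times_law.
Proof.
pose lvl x y := (size (string_decode x) + size (string_decode y))%N.
pose F x y := count_level (lvl x y) (fun w => prefix (string_decode x) w &&
  agrees_with_universal (string_decode y) w).
have [ca Hca] : recursive 3 (fun xs => F (nth 0%N xs 0) (nth 0%N xs 1)).
  by rewrite /F /lvl /count_level; rec.
(* The predecessor compensates for the denominator [d.+1] in [computable_real_fun2]. *)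
have [cd Hcd] : recursive 3 (fun xs => (2 ^ lvl (nth 0%N xs 0) (nth 0%N xs
  1)).-1%N).
  by rewrite /lvl; rec.
exists ca, MZero, cd => x y k.
exists (F (string_code x) (string_code y)), 0%N,
  (2 ^ lvl (string_code x) (string_code y)).-1%N; split=> //.
- exact/Hca.
- exact/Hcd.
rewrite prednK ?expn_gt0 // subr0 /F /lvl !string_codeK.
set L := (_ + _)%N; rewrite [X in fine X](_ : _ = lam [set u |
    prefix x (mkseq u L) && agrees_with_universal y (mkseq u L)]).
  rewrite (lam_level lam_cylinder L
    (fun w => prefix x w && agrees_with_universal y w)) /= natrX subrr normr0.
  by rewrite invr_ge0 exprn_ge0.
rewrite [LHS]times_lawE; congr (lam _).
have le_x : (size x <= L)%N by exact: leq_addr.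
have le_y : (size y <= L)%N by exact: leq_addl.
apply/seteqP; split=> u; rewrite /with_times /preimage /=.
  by move=> [/(cylinder_mkseqP u le_x) ->
    /(universal_times_cylinder u le_y) ->].
move=> /andP[ux uy]; split; first exact/(cylinder_mkseqP u le_x).
exact/(universal_times_cylinder u le_y).
Qed.

(** * The conditional measure along the zero sequence *)

Definition never : cantor := fun=> false.

Lemma never_cylinder (u : cantor) n : cylinder (mkseq never n) (universal_times
  u)
  <-> forall i, (i < n)%N -> ~~ universal (mkseq u i).
Proof.
split=> [H i lt_i|H].
  by have := cylinder_mkseq_nth H lt_i; rewrite /universal_times => ->.
rewrite /cylinder /mkset size_mkseq; apply/eq_in_map => i.
by rewrite mem_iota => /H/negbTE.
Qed.

Let U := universal_set.
Let mU : measurable U := measurable_universal_set.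

Definition avoids n :=
  [set u : cantor | forall i, (i < n)%N -> ~~ universal (mkseq u i)].

(** Continuity from above: the sets [avoids n] decrease to the complement of [U]. *)
Lemma lam_stage_cvg (S : set cantor) : measurable S ->
  lam (S `&` avoids n)
    @[n --> \oo] --> lam (S `&` ~` U).
Proof.
move=> mS; pose F n := S `&` avoids n.
have mF n : measurable (F n).
  apply: measurableI => //.
  rewrite (_ : avoids n = \bigcap_(i in `I_n) [set u | ~~ universal (mkseq u
    i)]).
    by apply: bigcap_measurableType => i _;
      exact: (measurable_level i (fun x => ~~ universal x)).
  by apply/seteqP; split.
have FE : \bigcap_n F n = S `&` ~` U.
  apply/seteqP; split=> u.
    move=> Fu; split; first by have [] := Fu 0%N I.
    by move=> [n un]; have [_ /(_ n (ltnSn n))] := Fu n.+1 I; rewrite un.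
  by move=> [Su nU] n _; split=> // i _; apply/negP => ui; apply: nU; exists i.
rewrite -FE; apply: (nonincreasing_cvg_mu (mu := lam)) => //.
- by apply: le_lt_trans (probability_le1 lam (mF 0%N)) _; rewrite ltry.
- by rewrite FE; apply: measurableI => //; exact: measurableC.
- by move=> m n le_mn; apply/subsetPset => u [Su H]; split=> // i lt_i;
    apply: H; exact: leq_trans le_mn.
Qed.

Let mlamC : measurable (~` U) := measurableC mU.

Let c := fine (lam (~` U)).

Let lamCE : lam (~` U) = c%:E.
Proof. by rewrite /c fineK // fin_num_measure. Qed.

Let c_ge : 2^-1 <= c.
Proof.
rewrite -lee_fin -lamCE probability_setC //.
have := lam_universal_set lam_cylinder; rewrite -/U.
rewrite -(@fineK _ (lam U)) ?fin_num_measure // lee_fin -EFinB lee_fin => H.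
by lra.
Qed.

Let c_gt0 : 0 < c.
Proof. by apply: lt_le_trans c_ge; rewrite invr_gt0. Qed.

Definition avoiding_law : probability cantor R :=
  mnormalize (mrestr lam mlamC) lam.

Lemma avoiding_lawE A : avoiding_law A = (lam (A `&` ~` U) * c^-1%:E)%E.
Proof.
apply: mnormalizeE; first exact: lt0r_neq0.
by rewrite /= /mrestr setTI.
Qed.

(** Numerators and denominators converge separately, and the limit [c] of the denominators is at
    least one half. *)
Lemma avoiding_conditional :
  is_conditional_measure times_law never avoiding_law.
Proof.
move=> S mS; rewrite avoiding_lawE.
have lawE A n : times_law (A `*` cylinder (mkseq never n)) =
    lam (A `&` avoids n).
  rewrite times_lawE; congr (lam _); apply/seteqP;
    split=> u [Au /never_cylinder uH];
  by split=> //; apply/never_cylinder.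
rewrite fineM ?fin_num_measure //; last exact: measurableI.
apply: cvgM.
  under eq_fun do rewrite lawE.
  apply: fine_cvg; rewrite fineK; first exact: lam_stage_cvg.
  by rewrite fin_num_measure //; exact: measurableI.
apply: cvgV; first exact: lt0r_neq0.
under eq_fun do rewrite lawE.
apply: fine_cvg; rewrite -lamCE -[X in _ --> lam X]setTI.
exact: lam_stage_cvg.
Qed.

Lemma random_pair (a : cantor) :
  ml_random lam a -> ~ U a -> ml_random2 times_law (a, never).
Proof.
move=> ra nUa V [[cV VE] lawV] Vab; set e := mu_code_num cV.
(* [z] extends some [p] and forces the record to extend [q], where [(p, q)] enters [V n] by time
   [t]. The equation on [q.+1] says that [q] is made of zeros, hence a prefix of [never]. *)
pose D t n z := exb t (fun p => exb t (fun q =>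
  [&& prefix (string_decode p) (string_decode z),
      halts_within e (ncode [:: n; p; q]) t,
      (size (string_decode q) <= size (string_decode z))%N,
      q.+1 == (2 ^ size (string_decode q))%N &
      agrees_with_universal (string_decode q) (string_decode z)])).
have [|d dP] := @halting_search D.
  by rewrite /recursive3 /D /ncode /=; rec.
pose W n := \bigcup_(x in [set x | mu_halts d [:: n;
  string_code x]]) cylinder x.
have mW n : measurable (W n).
  by apply: measurable_bigcup_countType => x _; exact: measurable_cylinder.
have mV n : measurable (V n).
  rewrite VE; apply: measurable_bigcup_countType => x _.
  by apply: measurableX; exact: measurable_cylinder.
apply: (ra W); first split; first by exists d.
  (* Each [W n] lies in the preimage of [V n] under [with_times]. *)
  move=> n; apply: le_trans (lawV n); rewrite [leRHS]times_lawE.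
  apply: le_measure; rewrite ?inE //.
    by rewrite -[X in measurable X]setTI; exact: measurable_with_times.
  move=> u [z /= /dP[t /exbP[p _ /exbP[q _ /and5P[pz hpq le_q _ ag]]]] zu].
  rewrite string_codeK in pz le_q ag.
  rewrite /preimage /= VE; exists (string_decode p, string_decode q) => /=.
    by apply/halts_withinP; exists t; rewrite !string_decodeK.
  split; first exact: cylinder_prefix pz _ zu.
  by apply/(universal_times_cylinder u le_q); rewrite zu.
move=> n _; have := Vab n I; rewrite VE => -[[x y] /=].
move=> /halts_withinP[t0 ht] [/= xa ynever].
pose m := maxn (size x) (size y); exists (mkseq a m);
  last exact: cylinder_mkseq.
apply/dP; pose t := maxn t0 (maxn (string_code x).+1 (string_code y).+1);
  exists t.
apply/exbP; exists (string_code x); first by rewrite /t; lia.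
apply/exbP; exists (string_code y); first by rewrite /t; lia.
have le_y : (size y <= m)%N by exact: leq_maxr.
rewrite !string_codeK size_mkseq le_y; apply/and5P; split=> //.
- by apply/(cylinder_mkseqP a) => //; exact: leq_maxl.
- by apply: halts_within_leq ht; rewrite /t; lia.
- rewrite -ynever; elim: (size y) => // k IH.
  rewrite mkseqS string_code_rcons -addSn (eqP IH) !size_rcons !size_mkseq.
  by rewrite muln1 addnn -mul2n expnS.
apply/(universal_times_cylinder a le_y); rewrite -ynever.
by apply/never_cylinder => i _; apply/negP => ui; apply: nUa; exists i.
Qed.

Lemma covered_universal_set (u : cantor) n :
  covered universal (mkseq u n) -> U u.
Proof.
move=> [s /covered_withinP H]; have [| |y yu uy] := H (mkseq u (n + s)).
- by rewrite !size_mkseq.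
- by rewrite prefixE size_mkseq take_mkseq // leq_addr.
have le_y : (size y <= n + s)%N by rewrite -(size_mkseq u (n + s)) size_prefix.
by exists (size y); move: yu; rewrite prefixE take_mkseq // => /eqP ->.
Qed.

Lemma leftmost_not_random (a : cantor) :
  (forall n, ~ covered universal (mkseq a n) /\
     (a n -> covered universal (rcons (mkseq a n) false))) ->
  ~ ml_random avoiding_law a.
Proof.
move=> Ha.
(* [w] has length [n.+1], and wherever it turns right the left sibling is covered within [s] further
   bits. *)
pose D s n w := (size (string_decode w) == n.+1) && allb w.+1 (fun v =>
  prefix (string_decode (string_code (rcons (string_decode v) true)))
    (string_decode w) ==>
  covered_within universal
    (string_decode (string_code (rcons (string_decode v) false))) s).
have [|d dP] := @halting_search D; first by rewrite /recursive3 /D; rec.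
pose V n := \bigcup_(x in [set x | mu_halts d [:: n;
  string_code x]]) cylinder x.
have DP s n w : D s n (string_code w) <-> size w = n.+1 /\
    forall v, prefix (rcons v true) w -> covered_within universal (rcons v
      false) s.
  rewrite /D string_codeK; split=> [/andP[/eqP sw /allbP H]|[-> H]].
    split=> // v vw; have := H (string_code v); rewrite !string_codeK vw.
    apply; rewrite ltnS string_code_prefix //.
    exact: prefix_trans (prefix_rcons _ _) vw.
  rewrite eqxx; apply/allbP => v _; rewrite !string_codeK; apply/implyP.
  exact: H.
have mV n : measurable (V n).
  by apply: measurable_bigcup_countType => x _; exact: measurable_cylinder.
move=> /(_ V); apply.
  split; first by exists d.
  move=> n; have sub : V n `&` ~` U `<=` cylinder (mkseq a n.+1).
    move=> u [[w /= /dP[s /DP[sw H]] wu] nU].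
    rewrite -sw in wu *.
    suff E i : (i <= size w)%N -> mkseq u i = mkseq a i.
      by rewrite /cylinder /mkset size_mkseq E.
    elim: i => // i IH lt_i; rewrite !mkseqS IH ?(ltnW lt_i) //; congr rcons.
    have uw b : u i = b -> prefix (rcons (mkseq a i) b) w.
      move=> <-; rewrite -IH ?(ltnW lt_i) // -mkseqS -wu prefixE size_mkseq.
      by rewrite take_mkseq.
    (* Where [u] goes right of [a], the prefix of [a] would be a covered sibling, which is excluded;
       where it goes left, the choice of [a] puts [u] in [U]. *)
    case ui: (u i); case ai: (a i) => //.
      have [/= na _] := Ha i.+1; case: na; rewrite mkseqS ai.
      by exists s; apply: H; exact: uw.
    case: nU; apply: (@covered_universal_set u i.+1).
    by rewrite mkseqS IH ?(ltnW lt_i) // ui; apply: (Ha i).2; rewrite ai.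
  (* Length [n.+1] instead of [n] pays for the division by [c], which is at least one half. *)
  rewrite [leLHS]avoiding_lawE lee_pdivrMr // -EFinM.
  apply: (@le_trans _ _ (lam (cylinder (mkseq a n.+1)))).
    apply: le_measure => //; rewrite inE; first exact: measurableI.
    exact: measurable_cylinder.
  rewrite [leLHS]lam_cylinder lee_fin size_mkseq exprS invfM mulrC.
  by rewrite ler_pM2l // invr_gt0 exprn_gt0.
move=> n _; exists (mkseq a n.+1); last exact: cylinder_mkseq.
apply/dP.
(* Only finitely many left siblings matter, so one stage covers them all. *)
have [s Hs] : exists s, forall i, (i < n.+1)%N -> a i ->
    covered_within universal (rcons (mkseq a i) false) s.
  elim: n.+1 => [|k [s IH]]; first by exists 0%N.
  have [ak|nak] := boolP (a k); last first.
    exists s => i; rewrite ltnS leq_eqVlt => /orP[/eqP ->|]; last exact: IH.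
    by rewrite (negbTE nak).
  have [s' Hs'] := (Ha k).2 ak; exists (maxn s s') => i.
  rewrite ltnS leq_eqVlt => /orP[/eqP ->|lt_i] ai.
    exact: covered_within_leq (leq_maxr _ _) Hs'.
  exact: covered_within_leq (leq_maxl _ _) (IH i lt_i ai).
exists s; apply/DP; split=> [|v /prefixP[z vz]]; first by rewrite size_mkseq.
have lt_v : (size v < n.+1)%N.
  by rewrite -(size_mkseq a n.+1) vz size_cat size_rcons leq_addr.
have vE : v = mkseq a (size v).
  rewrite -(take_mkseq _ (ltnW lt_v)) vz cat_rcons take_size_cat //.
rewrite vE; apply: Hs => //.
rewrite -(nth_mkseq false a lt_v) vz nth_cat size_rcons ltnSn.
by rewrite nth_rcons ltnn eqxx.
Qed.

End Counterexample.

Close Scope ring_scope.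
Close Scope classical_set_scope.

Theorem theorem5 (R : realType) :
  exists (P : probability (cantor * cantor)%type R) (alpha beta : cantor)
         (Q : probability cantor R),
    [/\ computable_measure2 P,
        ml_random2 P (alpha, beta),
        is_conditional_measure P beta Q
      & ~ ml_random Q alpha].
Proof.
have [lam lamE] := ex_uniform_measure R.
have [a Ha] : exists a : nat -> bool, forall n,
    ~ covered universal (mkseq a n) /\
    (a n -> covered universal (rcons (mkseq a n) false)).
  (* Were the empty string covered, [U] would be the whole space, of measure 1 rather than at most
     one half. *)
  apply: leftmost_uncovered => cov.
  have UT : universal_set = setT.
    by apply/seteqP; split=> // u _; exact: (@covered_universal_set u 0).
  have := lam_universal_set lamE; rewrite UT probability_setT lee_fin.
  by lra.
have nUa : ~ universal_set (a : cantor).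
  move=> [n un]; have [na _] := Ha n; apply: na.
  exact: covered_of_prefix (prefix_refl _) un.
exists (times_law lam), a, never, (avoiding_law lam); split.
- exact: computable_times_law.
- by apply: random_pair => // V tV Va; apply: nUa; exact: universal_setP tV Va.
- exact: avoiding_conditional.
- exact: leftmost_not_random.
Qed.
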